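(* Let $(X,d)$ be a metric space and $\phi:X\to(-\infty,+\infty]$ a proper lower semicontinuous functional. Let the following assumptions hold: 1. for some $\lambda\le0$ the $\mathrm{EVI}_\lambda$-gradient flow $\mathsf S_t$ of $\phi$ exists in $D\subset\overline{\mathrm{Dom}(\phi)}$; 2. for some $\tau\in(0,1)$ and $\eta\ge0$ such that $4\gamma\tau\le1$, where $\gamma:=2\eta-3\lambda$, the sequence $(U^n_{\tau,\eta})_{n\in\mathbb N}\subset D\cap\mathrm{Dom}(\phi)$ is a $(\tau,\eta)$-discrete Minimizing Movement; 3. $\phi$ is approximately $\lambda$-convex in $D$. Then, for all $u_0\in D$, the following estimate holds for every $t>0$: $$d\big(\mathsf S_t(u_0),\overline U_{\tau,\eta}(t)\big)\le e^{-\lambda t}d(u_0,U^0_{\tau,\eta})+10\,\sqrt[4]{\tau t_\tau}\;e^{2\gamma t_\tau}\sqrt{\phi(U^0_{\tau,\eta})-\phi_{\mathsf E_{\lambda-\eta}(3\sqrt{\tau t_\tau})}(U^0_{\tau,\eta})}.$$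
   Context: $\mathrm{Dom}(\phi):=\{x\in X:\phi(x)<+\infty\}$. $\mathsf E_a(t):=\int_0^te^{ar}\,\mathrm dr$. Moreau-Yosida regularization: $\phi_\sigma(x):=\inf_{y\in X}\big(\phi(y)+\frac1{2\sigma}d^2(y,x)\big)$, $\sigma>0$. $t_\tau:=\min\{k\tau:k\in\mathbb N,\ k\tau\ge t\}$. A $(\tau,\eta)$-discrete Minimizing Movement starting from $U^0_{\tau,\eta}\in\mathrm{Dom}(\phi)$ is a sequence $(U^n_{\tau,\eta})_{n\in\mathbb N}$ in $\mathrm{Dom}(\phi)$ such that for every $n\ge1$ $$\tfrac1{2\tau}d^2(U^n_{\tau,\eta},U^{n-1}_{\tau,\eta})+\phi(U^n_{\tau,\eta})\le\tfrac1{2\tau}d^2(V,U^{n-1}_{\tau,\eta})+\phi(V)+\tfrac\eta2\,d(U^n_{\tau,\eta},U^{n-1}_{\tau,\eta})\,d(V,U^n_{\tau,\eta})\quad\text{for every }V\in\mathrm{Dom}(\phi),$$ $$\tfrac1{2\tau}d^2(U^n_{\tau,\eta},U^{n-1}_{\tau,\eta})+\phi(U^n_{\tau,\eta})\le\phi(U^{n-1}_{\tau,\eta}).$$ Its piecewise constant interpolant is $\overline U_{\tau,\eta}(t):=U^n_{\tau,\eta}$ if $t\in((n-1)\tau,n\tau]$, $\overline U_{\tau,\eta}(0):=U^0_{\tau,\eta}$. For $\vartheta,\varepsilon\in(0,1)$, $x$ is a $(\vartheta,\varepsilon)$-intermediate point between $x_0,x_1$ if $\frac{d^2(x_0,x)}\vartheta+\frac{d^2(x,x_1)}{1-\vartheta}\le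 d^2(x_0,x_1)(1+\varepsilon^2\vartheta(1-\vartheta))$. $\phi$ is approximately $\lambda$-convex in $D$ if for every $x_0,x_1\in D\cap\mathrm{Dom}(\phi)$ and $\vartheta,\varepsilon\in(0,1)$ there is a $(\vartheta,\varepsilon)$-intermediate point $x_{\vartheta,\varepsilon}\in D$ between $x_0$ and $x_1$ with $\phi(x_{\vartheta,\varepsilon})\le(1-\vartheta)\phi(x_0)+\vartheta\phi(x_1)-\frac{\lambda-\varepsilon}2\vartheta(1-\vartheta)d^2(x_0,x_1)$. With $\frac{\mathrm d}{\mathrm dt}^{+}\zeta(t):=\limsup_{h\downarrow0}\frac{\zeta(t+h)-\zeta(t)}h$, a solution of $\mathrm{EVI}_\lambda(X,d,\phi)$ is a continuous curve $u:(0,+\infty)\to\mathrm{Dom}(\phi)$ with $\frac12\frac{\mathrm d}{\mathrm dt}^{+}d^2(u_t,v)+\frac\lambda2d^2(u_t,v)\le\phi(v)-\phi(u_t)$ for every $t>0$, $v\in\mathrm{Dom}(\phi)$. An $\mathrm{EVI}_\lambda$-gradient flow of $\phi$ in $D$ is a family of continuous maps $\mathsf S_t:D\to D$, $t\ge0$, such that for every $u_0\in D$: $\mathsf S_{t+h}(u_0)=\mathsf S_h(\mathsf S_t(u_0))$ for all $t,h\ge0$, $\lim_{t\downarrow0}\mathsf S_t(u_0)=\mathsf S_0(u_0)=u_0$, and $t\mapsto\mathsf S_t(u_0)$ is a solution of $\mathrm{EVI}_\lambda(X,d,\phi)$. *)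

(* Defs.v *)
From HB Require Import structures.
From mathcomp Require Import all_boot all_order all_algebra.
From mathcomp Require Import all_classical all_reals all_analysis.

Set Implicit Arguments.
Unset Strict Implicit.
Unset Printing Implicit Defensive.

Import Order.TTheory GRing.Theory Num.Theory.
Import numFieldNormedType.Exports.

Local Open Scope classical_set_scope.
Local Open Scope ring_scope.

Section Functional.
Context {R : realType} {X : metricType R}.
Implicit Types (phi : X -> \bar R) (D : set X).

Definition Dom phi : set X := [set x | (phi x < +oo)%E].

(* Since [phi] may take the value [-oo] in [\bar R], this is part of properness. *)
Definition proper_functional phi := (forall x, (-oo < phi x)%E) /\ Dom phi !=set0.

Definition moreau_yosida phi (sigma : R) (x : X) : \bar R :=
  ereal_inf [set (phi y + ((2 * sigma)^-1 * mdist y x ^+ 2)%:E)%E | y in [set: X]].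

Definition intermediate_point (theta eps : R) (x0 x1 x : X) :=
  mdist x0 x ^+ 2 / theta + mdist x x1 ^+ 2 / (1 - theta) <=
    mdist x0 x1 ^+ 2 * (1 + eps ^+ 2 * theta * (1 - theta)).

Definition approx_convex phi (lambda : R) D :=
  forall x0 x1, (D `&` Dom phi) x0 -> (D `&` Dom phi) x1 ->
  forall theta eps : R, 0 < theta < 1 -> 0 < eps < 1 ->
  exists x, [/\ D x, intermediate_point theta eps x0 x1 x &
    (phi x <= (1 - theta)%:E * phi x0 + theta%:E * phi x1
       - ((lambda - eps) / 2 * theta * (1 - theta) * mdist x0 x1 ^+ 2)%:E)%E].

End Functional.

Section GradientFlow.
Context {R : realType} {X : metricType R}.
Implicit Types (phi : X -> \bar R) (D : set X).

Definition dini_upper_right (zeta : R -> R) (t : R) : \bar R :=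
  limf_esup (fun h : R => ((zeta (t + h) - zeta t) / h)%:E) 0^'+.

(* Only the values of [u] on the open half-line matter. *)
Definition EVI_solution phi (lambda : R) (u : R -> X) :=
  [/\ forall t, 0 < t -> Dom phi (u t),
      {within [set t : R | 0 < t], continuous u} &
      forall t v, 0 < t -> Dom phi v ->
        ((2^-1)%:E * dini_upper_right (fun s => (mdist (u s) v ^+ 2)%R) t
         + (lambda / 2 * mdist (u t) v ^+ 2)%:E <= phi v - phi (u t))%E].

(* Only the values of [S t x] with [0 <= t] and [D x] matter. *)
Record EVI_gradient_flow phi (lambda : R) D (S : R -> X -> X) : Prop := {
  flow_stable : forall t x, 0 <= t -> D x -> D (S t x);
  flow_continuous : forall t, 0 <= t -> {within D, continuous (S t)};
  flow_semigroup : forall t h x, 0 <= t -> 0 <= h -> D x ->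
    S (t + h) x = S h (S t x);
  flow_cvg0 : forall x, D x -> S t x @[t --> 0^'+] --> x;
  flow_at0 : forall x, D x -> S 0 x = x;
  flow_EVI : forall x, D x -> EVI_solution phi lambda (S ^~ x) }.

End GradientFlow.

Section MinimizingMovement.
Context {R : realType} {X : metricType R}.
Implicit Types (phi : X -> \bar R) (U : nat -> X).

Definition discrete_MM phi (tau eta : R) U :=
  [/\ forall n, Dom phi (U n),
      forall n V, Dom phi V ->
        (((2 * tau)^-1 * mdist (U n.+1) (U n) ^+ 2)%:E + phi (U n.+1) <=
           ((2 * tau)^-1 * mdist V (U n) ^+ 2)%:E + phi V
           + (eta / 2 * mdist (U n.+1) (U n) * mdist V (U n.+1))%:E)%E &
      forall n,
        (((2 * tau)^-1 * mdist (U n.+1) (U n) ^+ 2)%:E + phi (U n.+1) <=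
           phi (U n))%E].

(* For [0 < t] and [0 < tau] the set is a singleton, by [interpolantE] below;
   at [t = 0] it is empty and the default index 0 is used. *)
Definition interpolant (tau : R) U (t : R) : X :=
  U (xget 0%N [set n : nat | (0 < n)%N /\ (n%:R - 1) * tau < t <= n%:R * tau]).

Lemma interpolantE (tau : R) U (t : R) (n : nat) : 0 < tau -> (0 < n)%N ->
  (n%:R - 1) * tau < t <= n%:R * tau -> interpolant tau U t = U n.
Proof.
move=> tau0 n0 tn; rewrite /interpolant; congr (U _).
suff le_idx (a b : nat) : (a%:R - 1) * tau < t <= a%:R * tau ->
    (b%:R - 1) * tau < t <= b%:R * tau -> (a <= b)%N.
  apply: xget_unique => // m [_ tm].
  by apply/eqP; rewrite eqn_leq !le_idx.
move=> /andP[at1 _] /andP[_ tb].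
have := lt_le_trans at1 tb.
by rewrite ltr_pM2r// ltrBlDr natr1 ltr_nat ltnS.
Qed.

Lemma interpolant0 (tau : R) U : 0 < tau -> interpolant tau U 0 = U 0%N.
Proof.
move=> tau0; rewrite /interpolant xgetPN// => n [n0] /andP[+ _].
by rewrite pmulr_llt0// subr_lt0 ltrn1 ltnNge n0.
Qed.

End MinimizingMovement.

Section Constants.
Context {R : realType}.

Definition least_multiple (tau t : R) : R :=
  inf [set s | exists k : nat, s = k%:R * tau /\ t <= s].

(* The infimum defining [least_multiple] is a minimum. *)
Lemma least_multiple_min (tau t : R) : 0 < tau ->
  exists k : nat, [/\ least_multiple tau t = k%:R * tau, t <= k%:R * tau &
    forall j : nat, t <= j%:R * tau -> k%:R * tau <= j%:R * tau].
Proof.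
move=> tau0.
have exk : exists k : nat, t <= k%:R * tau.
  exists (Num.bound `|t / tau|).
  by rewrite -ler_pdivrMr// (le_trans (ler_norm _))// ltW// archi_boundP ?normr_ge0.
case: (ex_minnP exk) => k tk kmin; exists k.
have kle (j : nat) : t <= j%:R * tau -> k%:R * tau <= j%:R * tau.
  by move=> /kmin kj; rewrite ler_pM2r// ler_nat.
split => //; apply/eqP; rewrite eq_le; apply/andP; split.
  apply: ge_inf; last by exists k.
  by exists t => s [j [_]].
by apply: lb_le_inf; [exists (k%:R * tau), k|move=> s [j [-> /kle]]].
Qed.

Definition exp_integral (a t : R) : R :=
  (\int[lebesgue_measure]_(r in `[0%R, t]) expR (a * r))%R.

End Constants.

(* Main.v *)
(** Two estimates are compared over one time step of length [tau]. For a point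
    [x] of [D] whose (global, [lambda]-corrected) slope is at most [s], the EVI
    tested at [v] gives, when [lambda = 0],
      [d (S_tau x, v)^2 <= d (x, v)^2 + 2 tau (phi v - phi x) + s^2 tau^2],
    because [phi] drops by at most [s^2 r] along the flow up to time [r].
    Testing minimality along the intermediate points provided by approximate
    convexity, and letting [theta = eps] tend to [0], shows that the slope at
    [U^n] is at most about [s_n := d (U^n, U^(n-1)) / tau] and that
    [phi (U^(n-1)) - phi (U^n)] is at least about [tau s_n^2]. Inserting
    [x = U^(n-1)] and [v = U^n] bounds the squared local error by
    [tau^2 (s_(n-1)^2 - s_n^2)], which telescopes under Cauchy-Schwarz: from
    step [j] to step [N] the error is at most [tau (N - j)^(1/2) s_j].
    Since the slope at [U^0] may be infinite, the first [j] steps, with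
    [j tau] at most [sigma / 2], are estimated by the triangle inequality
    through [U^0], and [j] is chosen so that [s_j^2] is at most the average of
    the [s_n^2] over these steps, which is of order
    [(phi (U^0) - phi_sigma (U^0)) / sigma]. *)
Require Import Defs.
From HB Require Import structures.
From mathcomp Require Import all_boot all_order all_algebra.
From mathcomp Require Import all_classical all_reals all_analysis.
From mathcomp Require Import ring lra.
Set Implicit Arguments.
Unset Strict Implicit.
Unset Printing Implicit Defensive.
Import Order.TTheory GRing.Theory Num.Theory.
Import numFieldNormedType.Exports.
Local Open Scope classical_set_scope.
Local Open Scope ring_scope.

(** * Comparison principle for upper right Dini derivatives *)

Section DiniComparison.
Context {R : realType}.
Implicit Types (F y w : R -> R) (t A L b : R).

(** An upper bound [A] on the upper right Dini derivative of [F] at [t], without quotients or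
    extended reals. *)
Definition dini_le F t A :=
  forall e, 0 < e -> \forall h \near 0^'+, F (t + h) <= F t + h * (A + e).

Lemma derive_near_lower y t A e : is_derive t 1 y A -> 0 < e ->
  \forall h \near 0^'+, y t + h * (A - e) <= y (t + h).
Proof.
move=> [dy eA] e0.
have /cvg_dnbhs_at_right cA : h^-1 *: (y (h *: 1 + t) - y t) @[h --> 0^'] --> A.
  by rewrite -eA.
near=> h.
have h0 : 0 < h by near: h; exact: nbhs_right_gt.
have : `|A - h^-1 *: (y (h *: 1 + t) - y t)| < e.
  by near: h; exact: cvgr_dist_lt.
rewrite ltr_norml => /andP[_]; rewrite /GRing.scale/= mulr1 ltrBlDr -ltrBlDl.
by rewrite ltr_pdivlMl// addrC (addrC h) => /ltW; lra.
Unshelve. all: by end_near. Qed.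

(* At the last time before [b] at which [w] is below
   [z t := d * expR ((L + 1) * t)], the two agree and [z' = (L + 1) z]
   exceeds the Dini derivative of [w]. *)
Lemma gronwall_dini w L b : 0 <= b -> continuous w -> w 0 <= 0 ->
  (forall t, 0 < t < b -> 0 < w t -> dini_le w t (L * w t)) -> w b <= 0.
Proof.
move=> b0 cw w0 dw; rewrite leNgt; apply/negP => wb.
(* This [d] gives [z b = w b / 2], so [z] is below [w] at [b], while at [0] it is positive and hence
   above [w]. *)
pose d := w b / 2 * expR (- ((L + 1) * b)).
have d0 : 0 < d by rewrite mulr_gt0 ?expR_gt0// divr_gt0.
pose z t := d * expR ((L + 1) * t).
have zE t h : 0 <= h -> z t * (1 + (L + 1) * h) <= z (t + h).
  move=> h0; rewrite /z (mulrDr (L + 1)) expRD -mulrA ler_pM2l// ler_pM2l ?expR_gt0//.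
  exact: expR_ge1Dx.
have z_gt0 t : 0 < z t by rewrite mulr_gt0 ?expR_gt0.
have zb : z b < w b.
  by rewrite /z /d -mulrA -expRD addNr expR0 mulr1 ltr_pdivrMr//; lra.
pose v t := w t - z t.
have cv : continuous v.
  move=> t; apply: cvgB; first exact: cw.
  apply: cvgM; first exact: cvg_cst.
  by apply: continuous_comp; [apply: mulrl_continuous|exact: continuous_expR].
pose E := [set t | 0 <= t <= b /\ v t <= 0].
have E0 : E 0.
  split; first by rewrite lexx b0.
  by rewrite subr_le0 (le_trans w0)// ltW.
have supE : has_sup E.
  by split; [exists 0|exists b => t [/andP[]]].
pose c := sup E.
have c0 : 0 <= c by apply: ub_le_sup => //; exact: supE.2.
have cb : c <= b by apply: ge_sup; [exists 0|move=> t [/andP[]]].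
have vc0 : v c <= 0.
  rewrite leNgt; apply/negP => vc.
  have /nbhs_ballP[/= r r0 rv] : \forall t \near c, 0 < v t.
    by apply: cvgr_gt (cv c) _ _.
  have [t Et ct] := sup_adherent r0 supE.
  have tc : t <= c by apply: ub_le_sup => //; exact: supE.2.
  case: Et => _; rewrite leNgt => /negP; apply; apply: rv.
  by rewrite /ball/= ger0_norm ?subr_ge0//; move: ct; rewrite -/c; lra.
have {cb} cb : c < b.
  rewrite lt_neqAle cb andbT; apply/eqP => cb'.
  by move: vc0; rewrite cb' /v subr_le0 leNgt zb.
have notE : \forall h \near 0^'+, 0 < v (c + h).
  near=> h.
  have h0 : 0 < h by near: h; exact: nbhs_right_gt.
  rewrite ltNge; apply/negP => vh.
  have : c + h <= c.
    apply: ub_le_sup; first exact: supE.2.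
    split=> //; apply/andP; split; first by lra.
    have : h <= b - c by near: h; apply: nbhs_right_le; lra.
    lra.
  lra.
have wc : w c = z c.
  apply/eqP; rewrite eq_le -subr_le0 vc0/= -subr_ge0 -/(v c).
  have cvc : v (c + h) @[h --> 0^'+] --> v c.
    apply: (@cvg_dnbhs_at_right _ _ (fun h => v (c + h)) 0).
    apply: cvg_within_filter; rewrite -[X in _ --> v X]addr0.
    apply: (@continuous_comp _ _ _ (fun h => c + h) v); last exact: cv.
    by apply: cvgD; [exact: cvg_cst|exact: cvg_id].
  rewrite leNgt; apply/negP => vc.
  have vneg : \forall h \near 0^'+, v (c + h) < 0 by exact: (cvgr_lt _ cvc).
  have : \forall h \near (0:R)^'+, False.
    by apply: filterS2 vneg notE => h /lt_trans/[apply]; rewrite ltxx.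
  by move=> /filter_ex[].
have {c0} c0 : 0 < c.
  rewrite lt_neqAle c0 andbT; apply/eqP => c0'.
  by have := z_gt0 c; rewrite -wc -c0' ltNge w0.
have : \forall h \near (0:R)^'+, False.
  have wc0 : 0 < w c by rewrite wc.
  have cb0 : 0 < c < b by rewrite c0.
  near=> h.
  have h0 : 0 < h by near: h; exact: nbhs_right_gt.
  have : 0 < v (c + h) by near: h; exact: notE.
  (* The slack is [z c], exactly what the extra [1] in the exponent of [z] contributes. *)
  have : w (c + h) <= w c + h * (L * w c + z c).
    by near: h; exact: dw.
  have := zE c h (ltW h0).
  rewrite /v wc; lra.
by move=> /filter_ex[].
Unshelve. all: by end_near. Qed.

(** [gronwall_dini] for [F - y]. The term [L * (F t - y t)] absorbs the part of the EVI that is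
    linear in the unknown, and a bound required only where [F] exceeds [y] lets callers use
    positivity there. *)
Lemma dini_comparison F y dy L b : 0 <= b -> continuous F ->
  (forall t, is_derive t 1 y (dy t)) -> F 0 <= y 0 ->
  (forall t, 0 < t < b -> y t < F t -> dini_le F t (dy t + L * (F t - y t))) ->
  F b <= y b.
Proof.
move=> b0 cF dery F0 dF; rewrite -subr_le0.
apply: (@gronwall_dini (fun t => F t - y t) L b) => //.
- move=> t; apply: cvgB; first exact: cF.
  have [dyt _] := dery t.
  exact/differentiable_continuous/derivable1_diffP.
- by rewrite subr_le0.
move=> t tb; rewrite subr_gt0 => Fy e e0; have e20 : 0 < e / 2 by lra.
have hF := dF t tb Fy _ e20; have hy := derive_near_lower (dery t) e20.
near=> h.
have : F (t + h) <= F t + h * (dy t + L * (F t - y t) + e / 2) by near: h.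
have : y t + h * (dy t - e / 2) <= y (t + h) by near: h.
lra.
Unshelve. all: by end_near. Qed.

End DiniComparison.

(** * The primitive of the exponential and its elementary bounds *)

Section ExpIntegral.
Context {R : realType}.
Implicit Types (L a r t x : R).

(** Padé bound with the denominator cleared: the derivative of [f] is nonnegative because
    [expR (- t) >= 1 - t]. *)
Lemma expR_pade x : 0 <= x -> expR x * (2 - x) <= 2 + x.
Proof.
rewrite le_eqVlt => /predU1P[<-|x0]; first by rewrite expR0; lra.
pose f t := 2 + t - expR t * (2 - t).
have df t : is_derive t 1 f (1 - expR t * (1 - t)).
  apply: is_derive_eq; rewrite /GRing.scale/=; ring.
have cf : {within `[0, x], continuous f}.
  apply: continuous_subspaceT => t; have [dft _] := df t.
  exact/differentiable_continuous/derivable1_diffP.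
have [c _ fE] := MVT x0 (fun t _ => df t) cf.
have : 0 <= f x - f 0.
  rewrite fE mulr_ge0//; last by lra.
  have := expR_ge1Dx (- c); rewrite expRN.
  have := expR_gt0 c => ec0 ec.
  have := ler_wpM2l (ltW ec0) ec; rewrite mulfV ?gt_eqF//; lra.
by rewrite /f expR0; lra.
Qed.

(** Closed form of [exp_integral], differentiable on the whole line, so that it can serve in
    comparison functions. *)
Definition expint L r := if L == 0 then r else (expR (L * r) - 1) / L.

Lemma expintE L r : L * expint L r = expR (L * r) - 1.
Proof.
rewrite /expint; case: eqVneq => [->|L0]; first by rewrite !mul0r expR0 subrr.
by rewrite mulrC divfK.
Qed.

Lemma expint0r L : expint L 0 = 0.
Proof. by rewrite /expint mulr0 expR0 subrr mul0r if_same. Qed.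

Lemma is_derive_expint L t : is_derive t 1 (expint L) (expR (L * t)).
Proof.
rewrite /expint; case: eqVneq => [->|L0].
  by rewrite mul0r expR0; exact: is_derive_id.
have dL : is_derive t (1:R) ( *%R L) L.
  apply: is_derive_eq; rewrite /GRing.scale/=; ring.
have -> : expR (L * t) = L^-1 * (L * expR (L * t)) by rewrite mulKf.
have de : is_derive t (1:R) (fun r => expR (L * r)) (L * expR (L * t)).
  have := @is_derive1_comp _ expR ( *%R L) t _ _ (is_derive_expR _) dL.
  by rewrite mulrC.
apply: is_derive_eq; by rewrite /GRing.scale/=; field.
Qed.

Lemma is_derive_expRM L t : is_derive t 1 (fun r => expR (L * r)) (L * expR (L * t)).
Proof.
have -> : (fun r => expR (L * r)) = (fun r => 1 + L * expint L r).
  by apply/funext => r; rewrite expintE; ring.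
have := is_derive_expint L t => d.
apply: is_derive_eq; rewrite /GRing.scale/=; ring.
Qed.

Lemma expint_ge L r : 0 <= L -> r <= expint L r.
Proof.
rewrite le_eqVlt => /predU1P[<-|L0]; first by rewrite /expint eqxx.
by rewrite -(ler_pM2l L0) expintE; have := expR_ge1Dx (L * r); lra.
Qed.

Lemma expint_ge0 L r : 0 <= L -> 0 <= r -> 0 <= expint L r.
Proof. by move=> L0 /le_trans; apply; exact: expint_ge. Qed.

Lemma expint_pade L r : 0 <= L -> 0 <= r -> expint L r * (2 - L * r) <= 2 * r.
Proof.
rewrite le_eqVlt => /predU1P[<-|L0] r0; first by rewrite /expint eqxx; lra.
rewrite -(ler_pM2l L0) mulrA expintE.
have := @expR_pade (L * r) (mulr_ge0 (ltW L0) r0); lra.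
Qed.

Lemma expint_le L r : 0 <= L -> expint L r <= r * expR (L * r).
Proof.
rewrite le_eqVlt => /predU1P[<-|L0]; first by rewrite /expint eqxx mul0r expR0 mulr1.
rewrite -(ler_pM2l L0) expintE mulrA.
have := expR_ge1Dx (- (L * r)); rewrite expRN.
have e0 := expR_gt0 (L * r).
move=> /(ler_wpM2l (ltW e0)); rewrite mulfV ?gt_eqF//; lra.
Qed.

Lemma expintN_le L r : 0 <= L -> expint (- L) r <= r.
Proof.
rewrite le_eqVlt => /predU1P[<-|L0]; first by rewrite oppr0 /expint eqxx.
rewrite -(ler_pM2l L0) -[L * expint _ _]opprK -mulNr expintE.
by have := expR_ge1Dx (- L * r); lra.
Qed.

Lemma exp_integralE a t : 0 <= t -> exp_integral a t = expint a t.
Proof.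
rewrite le_eqVlt => /predU1P[<-|t0].
  by rewrite /exp_integral set_itv1 Rintegral_set1 expint0r.
rewrite /exp_integral /Rintegral.
have cE : continuous (expint a).
  move=> r; have [d _] := is_derive_expint a r.
  exact/differentiable_continuous/derivable1_diffP.
rewrite (@continuous_FTC2 _ _ (expint a))//.
- by rewrite -EFinB/= expint0r subr0.
- apply: continuous_subspaceT => r.
  have [d _] := is_derive_expRM a r.
  exact/differentiable_continuous/derivable1_diffP.
- split.
  + by move=> r _; have [] := is_derive_expint a r.
  + exact/cvg_at_right_filter/cE.
  + exact/cvg_at_left_filter/cE.
- by move=> r _; rewrite derive1E; have [_ ->] := is_derive_expint a r.
Qed.

End ExpIntegral.

(** * Limits of distances and lower semicontinuity along filters *)

Section MetricLimits.
Context {R : realType} {X : metricType R}.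

Lemma mdist_sym (x y : X) : mdist x y = mdist y x.
Proof. exact: metric_sym. Qed.

Lemma mdist_le (x y x' y' : X) :
  mdist x y <= mdist x' y' + (mdist x' x + mdist y' y).
Proof.
have := metric_triangle x x' y; have := metric_triangle x' y' y.
by rewrite (mdist_sym x x'); lra.
Qed.

Lemma cvg_mdist {T : Type} {F : set_system T} {FF : Filter F} (u v : T -> X) x y :
  u @ F --> x -> v @ F --> y -> mdist (u t) (v t) @[t --> F] --> mdist x y.
Proof.
move=> ux vy; apply/cvgrPdist_lt => e e0; have e20 : 0 < e / 2 by lra.
have near_dist (w : T -> X) z : w @ F --> z ->
    \forall t \near F, mdist z (w t) < e / 2.
  by move=> wz; have := wz _ (nbhsx_ballx z _ e20); rewrite ballEmdist.
have nu := near_dist _ _ ux; have nv := near_dist _ _ vy.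
near=> t.
have : mdist x (u t) < e / 2 by near: t.
have : mdist y (v t) < e / 2 by near: t.
have := mdist_le x y (u t) (v t); have := mdist_le (u t) (v t) x y.
rewrite (mdist_sym (u t) x) (mdist_sym (v t) y) => *.
by rewrite ltr_norml; apply/andP; split; lra.
Unshelve. all: by end_near. Qed.

Lemma lsc_cvg_near {T : Type} {F : set_system T} {FF : Filter F}
    (phi : X -> \bar R) (u : T -> X) x a :
  lower_semicontinuous phi -> u @ F --> x -> (a%:E < phi x)%E ->
  \forall t \near F, (a%:E < phi (u t))%E.
Proof.
move=> lsc ux ax; have [V Vx Va] := lsc _ _ ax.
have uV : \forall t \near F, V (u t) by exact: ux.
by near=> t; apply: Va; near: t.
Unshelve. all: by end_near. Qed.

End MetricLimits.

(** Algebra for [flow_contraction]: [g] and [G] are squared distances before and after a short time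
    [h], [q] is the one with a single point moved, and [a], [b], [c] are energies. Inserting the
    bound for [q] cancels [b] up to [l * e * (c - b)] and leaves [c - a], which lower semicontinuity
    makes small. *)
Lemma contraction_step {R : realType} (l e h d g a b c q G eps : R) :
  0 <= l -> 0 <= h -> 0 <= e -> 0 <= d -> d <= 1 -> e <= h * (1 + d) -> e <= d ->
  0 <= g -> l * e * (c - b) <= d -> c - a <= d ->
  G <= (1 + l * e) * q + 2 * e * (b - a) ->
  q <= (1 + l * e) * g + 2 * e * (c - b) ->
  d * (8 + 2 * l * g + 2 * l ^+ 2 * g) <= eps ->
  G <= g + h * (2 * l * g + eps).
Proof.
move=> l0 h0 e0 d0 d1 eh ed g0 cb ca hG hq deps.
have le0 : 0 <= 1 + l * e by rewrite addr_ge0 ?mulr_ge0.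
have hG2 : G <= (1 + l * e) ^+ 2 * g + 4 * e * d.
  have := ler_wpM2l le0 hq.
  have : 2 * e * (l * e * (c - b) + (c - a)) <= 2 * e * (d + d).
    by rewrite ler_wpM2l ?mulr_ge0// lerD.
  move: hG; clear; lra.
have dh : h * d <= h by rewrite -[leRHS]mulr1 ler_wpM2l.
have e2h : e <= 2 * h by move: eh dh; clear; lra.
have ed2 : e * d <= 2 * (h * d) by move: (ler_wpM2r d0 e2h); clear; lra.
have ee : e * e <= e * d by rewrite ler_wpM2l.
have lsq : l ^+ 2 * (e * e) <= l ^+ 2 * (2 * (h * d)).
  by rewrite ler_wpM2l ?sqr_ge0// (le_trans ee).
have le2 : (1 + l * e) ^+ 2 <= 1 + 2 * l * h + h * d * (2 * l + 2 * l ^+ 2).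
  by move: (ler_wpM2l l0 eh) lsq; clear; lra.
have := ler_wpM2l h0 deps; have := ler_wpM2r g0 le2.
by move: hG2 ed2; clear; lra.
Qed.

(** * Regularity, energy decay and contraction of the EVI flow *)

Section EVIFlow.
Context {R : realType} {X : metricType R} (phi : X -> \bar R) (D : set X)
  (lambda : R) (S : R -> X -> X).
Hypothesis phi_proper : proper_functional phi.
Hypothesis phi_lsc : lower_semicontinuous phi.
Hypothesis lambda_le0 : lambda <= 0.
Hypothesis S_flow : EVI_gradient_flow phi lambda D S.
Implicit Types (x y v : X) (r s t : R).

Local Notation f x := (fine (phi x)).
Local Notation L := (- lambda).
Local Notation E := (expint L).

Lemma fine_phiK x : Dom phi x -> (f x)%:E = phi x.
Proof.
by move=> xfin; rewrite fineK// fin_numE -ltNye -ltey phi_proper.1 xfin.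
Qed.

(* Extending the curve constantly to negative times makes it continuous on
   all of [R]. *)
Definition flow x r := S (Num.max r 0) x.

Lemma flowE x r : 0 <= r -> flow x r = S r x.
Proof. by move=> r0; rewrite /flow max_l. Qed.

Lemma flow_in x r : D x -> D (flow x r).
Proof. by apply: (flow_stable S_flow); rewrite le_max lexx orbT. Qed.

Lemma flow0 x : D x -> flow x 0 = x.
Proof. by move=> Dx; rewrite flowE// (flow_at0 S_flow). Qed.

Lemma flowD x s r : 0 <= s -> 0 <= r -> D x ->
  flow x (s + r) = flow (flow x s) r.
Proof.
move=> s0 r0 Dx; rewrite !flowE ?addr_ge0//.
exact: (flow_semigroup S_flow).
Qed.

Lemma flow_Dom x r : D x -> 0 < r -> Dom phi (flow x r).
Proof.
by move=> Dx r0; rewrite flowE ?ltW//; have [+ _ _] := flow_EVI S_flow Dx; apply.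
Qed.

Lemma flow_Dom_ge0 x r : D x -> Dom phi x -> 0 <= r -> Dom phi (flow x r).
Proof.
move=> Dx fx; rewrite le_eqVlt => /predU1P[<-|]; first by rewrite flow0.
exact: flow_Dom.
Qed.

Lemma continuous_flow x : D x -> continuous (flow x).
Proof.
move=> Dx r; have [r0|r0|->] := ltgtP r 0.
- apply: (@near_cst_continuous _ _ x); near=> s.
  have s0 : s <= 0 by apply: ltW; near: s; exact: lt_nbhsl.
  by rewrite /flow max_r ?(flow_at0 S_flow).
- have [_ cS _] := flow_EVI S_flow Dx.
  have {}cS : S ^~ x s @[s --> r] --> S r x.
    move: cS; rewrite continuous_open_subspace; last exact: open_gt.
    by apply; rewrite inE.
  rewrite /continuous_at (flowE _ (ltW r0)); apply: cvg_trans cS.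
  apply: near_eq_cvg; near=> s.
  by rewrite flowE//; apply: ltW; near: s; exact: lt_nbhsr.
- apply/left_right_continuousP; split.
    apply: cvg_near_cst; near=> s.
    have s0 : s <= 0 by near: s; exact: nbhs_left_le.
    by rewrite flow0// /flow max_r ?(flow_at0 S_flow).
  rewrite flow0//; apply: cvg_trans (flow_cvg0 S_flow Dx).
  apply: near_eq_cvg; near=> s.
  by rewrite flowE//; near: s; exact: nbhs_right_ge.
Unshelve. all: by end_near. Qed.

Lemma flow_dini x v t : D x -> Dom phi v -> 0 < t ->
  dini_le (fun r => mdist (flow x r) v ^+ 2) t
    (L * mdist (flow x t) v ^+ 2 + 2 * (f v - f (flow x t))).
Proof.
move=> Dx fv t0 e e0.
have fu : Dom phi (S t x) by rewrite -flowE ?ltW//; exact: flow_Dom.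
have [_ _ /(_ t v t0 fv)] := flow_EVI S_flow Dx.
rewrite -(fine_phiK fv) -(fine_phiK fu) flowE; last exact: ltW.
set F := fun s => mdist (S s x) v ^+ 2.
set A := L * _ + _.
have : (dini_upper_right F t < (A + e)%:E)%E ->
    \forall h \near 0^'+, F (t + h) <= F t + h * (A + e).
  rewrite /dini_upper_right /limf_esup => /ereal_inf_lt[_ [V V0 <-] supV].
  near=> h.
  have h0 : 0 < h by near: h; exact: nbhs_right_gt.
  have Vh : V h by near: h.
  have : (((F (t + h) - F t) / h)%:E <= (A + e)%:E)%E.
    apply: le_trans (ltW supV); apply: ereal_sup_ubound; by exists h.
  by rewrite lee_fin ler_pdivrMr// lerBlDl mulrC.
move=> near_dini dini.
have {near_dini} : \forall h \near 0^'+, F (t + h) <= F t + h * (A + e).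
  apply: near_dini; move: dini; rewrite -/(F t).
  (* The value [+oo] contradicts the finite right-hand side of the EVI; [-oo] satisfies every upper
     bound. *)
  case: (dini_upper_right F t) => //=.
  - by move=> r; rewrite lee_fin lte_fin /A => *; rewrite -/(F t); lra.
  - by rewrite gt0_muley ?lte_fin ?invr_gt0//= leye_eq.
  - by rewrite ltNyr.
apply: filter_app; near=> h.
have h0 : 0 < h by near: h; exact: nbhs_right_gt.
by rewrite /F !flowE//; apply/ltW => //; exact: addr_gt0.
Unshelve. all: by end_near. Qed.

Lemma dini_le_trans (F : R -> R) t A B : A <= B -> dini_le F t A -> dini_le F t B.
Proof.
move=> AB dF e e0; have hF := dF e e0; near=> h.
have h0 : 0 <= h by near: h; exact: nbhs_right_ge.
have : F (t + h) <= F t + h * (A + e) by near: h.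
have := ler_wpM2l h0 AB; lra.
Unshelve. all: by end_near. Qed.

Lemma continuous_flow_sqdist x v : D x ->
  continuous (fun r => mdist (flow x r) v ^+ 2).
Proof.
move=> Dx r; rewrite /continuous_at expr2.
have : mdist (flow x s) v @[s --> r] --> mdist (flow x r) v.
  by apply: cvg_mdist; [exact: continuous_flow|exact: cvg_cst].
by move=> c; apply: cvgM.
Qed.

(** Otherwise there is a last time [c] before [t] with energy at most [f x], attained by lower
    semicontinuity. Afterwards the energy exceeds that of [flow x c], so the EVI tested at this very
    point keeps the flow there up to time [t], a contradiction. *)
Lemma flow_energy_le x t : D x -> Dom phi x -> 0 <= t ->
  f (flow x t) <= f x.
Proof.
move=> Dx fx t0; rewrite leNgt; apply/negP => xt.
pose Z := [set r | 0 <= r <= t /\ f (flow x r) <= f x].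
have Z0 : Z 0 by rewrite /Z/= flow0// lexx t0.
have supZ : has_sup Z by split; [exists 0|exists t => r [/andP[]]].
pose c := sup Z.
have c0 : 0 <= c by apply: ub_le_sup => //; exact: supZ.2.
have ct : c <= t by apply: ge_sup; [exists 0|move=> r [/andP[]]].
have fc := flow_Dom_ge0 Dx fx c0.
have le_c : f (flow x c) <= f x.
  rewrite leNgt; apply/negP => gt_c.
  have gtc : ((f x)%:E < phi (flow x c))%E by rewrite -(fine_phiK fc) lte_fin.
  have /nbhs_ballP[/= d d0 dZ] :
      \forall r \near c, ((f x)%:E < phi (flow x r))%E.
    exact: lsc_cvg_near phi_lsc (@continuous_flow x Dx c) gtc.
  have [r Zr cr] := sup_adherent d0 supZ.
  have rc : r <= c by apply: ub_le_sup => //; exact: supZ.2.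
  case: Zr => /andP[r0 _]; rewrite leNgt => /negP; apply.
  rewrite -lte_fin (fine_phiK (flow_Dom_ge0 Dx fx r0)); apply: dZ.
  by rewrite /ball/= ger0_norm ?subr_ge0//; move: cr; rewrite -/c; lra.
have {ct} ct : c < t.
  rewrite lt_neqAle ct andbT; apply/eqP => ct'.
  by move: le_c; rewrite ct' leNgt xt.
have Dc := flow_in c Dx.
have gt_c r : 0 < r < t - c -> f (flow x c) < f (flow (flow x c) r).
  move=> /andP[r0 rt]; rewrite -flowD// ?ltW//; apply: le_lt_trans le_c _.
  rewrite ltNge; apply/negP => ler.
  have : c + r <= c.
    apply: ub_le_sup; first exact: supZ.2.
    by split=> //; apply/andP; split; lra.
  lra.
have tc0 : 0 <= t - c by lra.
have : mdist (flow (flow x c) (t - c)) (flow x c) ^+ 2 <= 0.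
  apply: (@dini_comparison _ (fun r => mdist (flow (flow x c) r) (flow x c) ^+ 2)
    (cst 0) (cst 0) L) => //.
  - exact: continuous_flow_sqdist.
  - by rewrite /cst/= flow0// mdistxx expr0n.
  move=> r rt _; apply: dini_le_trans (flow_dini Dc fc _); last by case/andP: rt.
  by have := gt_c r rt; rewrite /cst/=; lra.
rewrite -flowD// subrKC => /(conj (sqr_ge0 (mdist (flow x t) (flow x c))))/andP.
rewrite -eq_le eq_sym sqrf_eq0 => /eqP/mdist_positivity E.
by move: le_c; rewrite -E leNgt xt.
Qed.

Lemma flow_energy_nincr x s t : D x -> 0 < s <= t ->
  f (flow x t) <= f (flow x s).
Proof.
move=> Dx /andP[s0 st]; rewrite -[t in leLHS](subrKC s).
rewrite flowD ?subr_ge0//; last exact: ltW.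
by apply: flow_energy_le; [exact: flow_in|exact: flow_Dom|rewrite subr_ge0].
Qed.

(** Since the energy decreases, the EVI can be compared with
    [y' = L * y + 2 * (f v - f (flow x t))], which the right-hand side solves. *)
Lemma flow_EVI_integral x v t : D x -> Dom phi v -> 0 <= t ->
  mdist (flow x t) v ^+ 2 <=
    expR (L * t) * mdist x v ^+ 2 + 2 * E t * (f v - f (flow x t)).
Proof.
move=> Dx fv t0; set K := f v - _.
set F0 := mdist x v ^+ 2.
pose y r := expR (L * r) * F0 + 2 * E r * K.
apply: (@dini_comparison _ (fun r => mdist (flow x r) v ^+ 2) y
  (fun r => L * expR (L * r) * F0 + 2 * expR (L * r) * K) L _ t0).
- exact: continuous_flow_sqdist.
- move=> r; have d1 := is_derive_expRM L r; have d2 := is_derive_expint L r.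
  apply: is_derive_eq; rewrite /GRing.scale/=; ring.
- by rewrite /y flow0// mulr0 expR0 expint0r /F0; lra.
move=> r rt _; apply: dini_le_trans (flow_dini Dx fv _); last by case/andP: rt.
have : f (flow x t) <= f (flow x r).
  by apply: flow_energy_nincr => //; case/andP: rt => -> /ltW.
have eE : expR (L * r) = 1 + L * E r by rewrite expintE; ring.
rewrite /y /K eE; lra.
Qed.

(** The EVI has a fixed test point, so over a short time [h] the two points are moved one after the
    other: the curve from [x'] is tested at the moved [y'], the curve from [y'] at [x']. *)
Lemma flow_contraction x y t : D x -> D y -> 0 <= t ->
  mdist (flow x t) (flow y t) <= expR (L * t) * mdist x y.
Proof.
move=> Dx Dy t0; rewrite -ler_sqr ?nnegrE ?mulr_ge0 ?expR_ge0 ?mdist_ge0//.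
rewrite exprMn -expRM_natl.
set g0 := mdist x y ^+ 2; pose g r := mdist (flow x r) (flow y r) ^+ 2.
have -> : 2%:R * (L * t) = (2 * L) * t by ring.
apply: (@dini_comparison _ g (fun r => expR ((2 * L) * r) * g0)
  (fun r => (2 * L) * expR ((2 * L) * r) * g0) (2 * L) _ t0).
- move=> r; rewrite /g /continuous_at expr2.
  have c : mdist (flow x s) (flow y s) @[s --> r] --> mdist (flow x r) (flow y r).
    by apply: cvg_mdist; exact: continuous_flow.
  exact: cvgM.
- move=> r; have d1 := is_derive_expRM (2 * L) r.
  apply: is_derive_eq; rewrite /GRing.scale/=; ring.
- by rewrite /g !flow0// mulr0 expR0 mul1r.
move=> {t t0} t /andP[t0 _] _.
have -> : 2 * L * expR (2 * L * t) * g0 + 2 * L * (g t - expR (2 * L * t) * g0)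
  = 2 * L * g t by ring.
have t0' := ltW t0.
set x' := flow x t; set y' := flow y t.
have Dx' : D x' by exact: flow_in.
have Dy' : D y' by exact: flow_in.
have fx' : Dom phi x' by exact: flow_Dom.
have fy' : Dom phi y' by exact: flow_Dom.
have gt0 : 0 <= g t by exact: sqr_ge0.
have L0 : 0 <= L by rewrite oppr_ge0.
move=> e e0.
(* The factor of [d] in the smallness condition of [contraction_step]. *)
pose C := 8 + 2 * L * g t + 2 * L ^+ 2 * g t.
have C8 : 8 <= C.
  by have := mulr_ge0 L0 gt0; have := mulr_ge0 (sqr_ge0 L) gt0; rewrite /C; lra.
pose d := Num.min 1 (e / C).
have d0 : 0 < d by rewrite lt_min ltr01 divr_gt0//; lra.
have d1 : d <= 1 by rewrite ge_min lexx.
have dC : d * C <= e by rewrite -ler_pdivlMr ?ge_min ?lexx ?orbT//; lra.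
(* Bounds [f x' - f (flow y' h)] once lower semicontinuity has given [f y' - 1 < f (flow y' h)]. *)
pose M := `|f x' - f y'| + 1.
have M1 : 1 <= M by rewrite /M lerDr.
have near_exp : \forall h \near 0^'+, expR (L * h) < 1 + d.
  have : expR (L * h) @[h --> 0^'+] --> expR (L * 0).
    apply: cvg_at_right_filter; apply: continuous_comp; last exact: continuous_expR.
    exact: mulrl_continuous.
  by rewrite mulr0 expR0 => c; apply: (cvgr_lt _ c); lra.
have near_lsc z a : D z -> a < f z -> Dom phi z ->
    \forall h \near 0^'+, (a%:E < phi (flow z h))%E.
  move=> Dz az fz; apply: lsc_cvg_near phi_lsc _ (_ : (a%:E < phi z)%E).
    rewrite -[X in _ --> X](flow0 Dz).
    by apply: cvg_within_filter; exact: continuous_flow.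
  by rewrite -fine_phiK.
have near_x : \forall h \near 0^'+, ((f x' - d)%:E < phi (flow x' h))%E.
  by apply: near_lsc => //; lra.
have near_y : \forall h \near 0^'+, ((f y' - 1)%:E < phi (flow y' h))%E.
  by apply: near_lsc => //; lra.
have dLM : 0 < d / (2 * (L * M + 1)).
  by rewrite divr_gt0// mulr_gt0//; have := mulr_ge0 L0 (le_trans ler01 M1); lra.
near=> h.
have h0 : 0 < h by near: h; exact: nbhs_right_gt.
have hx : f x' - d < f (flow x' h).
  by rewrite -lte_fin (fine_phiK (flow_Dom Dx' h0)); near: h.
have hy : f y' - 1 < f (flow y' h).
  by rewrite -lte_fin (fine_phiK (flow_Dom Dy' h0)); near: h.
have Eh : E h <= h * (1 + d).
  apply: le_trans (expint_le _ L0) _; rewrite ler_pM2l//; apply: ltW.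
  by near: h.
have E0 : 0 <= E h by rewrite expint_ge0// ltW.
have hd2 : h <= d / 2 by near: h; apply: nbhs_right_le; lra.
have E2h : E h <= 2 * h.
  by apply: le_trans Eh _; rewrite mulrC; apply: ler_wpM2r; [exact: ltW|lra].
have Ed : E h <= d by lra.
have hLM : h <= d / (2 * (L * M + 1)) by near: h; exact: nbhs_right_le.
have LM0 : 0 <= L * M := mulr_ge0 L0 (le_trans ler01 M1).
have LEM : L * E h * M <= d.
  have LM1 : 0 < 2 * (L * M + 1) by lra.
  move: hLM (ler_wpM2l LM0 E2h); rewrite ler_pdivlMr//.
  by lra.
have hg : g (t + h) = mdist (flow x' h) (flow y' h) ^+ 2.
  by rewrite /g (flowD t0' (ltW h0) Dx) (flowD t0' (ltW h0) Dy).
have h1 := flow_EVI_integral Dx' (flow_Dom Dy' h0) (ltW h0).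
have h2 := flow_EVI_integral Dy' fx' (ltW h0).
have eE : expR (L * h) = 1 + L * E h by rewrite expintE; ring.
move: h1 h2; rewrite eE (mdist_sym x' (flow y' h)) (mdist_sym y' x').
rewrite -/(g t) hg => h1 h2.
apply: (contraction_step L0 (ltW h0) E0 (ltW d0) d1 Eh Ed gt0 _ _ h1 h2 dC).
- apply: le_trans LEM; apply: ler_wpM2l; first exact: mulr_ge0.
  by rewrite /M; have := ler_norm (f x' - f y'); lra.
- by lra.
Unshelve. all: by end_near. Qed.

(** Global form of a bound on the descending slope; the quadratic term accounts for the convexity
    constant [lambda]. *)
Definition slope_le s x := forall y, D y -> Dom phi y ->
  f x - f y <= s * mdist y x + L / 2 * mdist y x ^+ 2.

(** The EVI tested at the starting point and the slope bound give, for the distance [F], that the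
    derivative of [F ^+ 2] is at most [2 * L * F ^+ 2 + 2 * s * F]; dividing by [2 * F] leaves
    [L * F + s]. *)
Lemma flow_dist_le x s t : D x -> Dom phi x -> 0 <= s -> slope_le s x ->
  0 <= t -> mdist (flow x t) x <= s * E t.
Proof.
move=> Dx fx s0 slx t0.
have L0 : 0 <= L by rewrite oppr_ge0.
apply: (@dini_comparison _ (fun r => mdist (flow x r) x) (fun r => s * E r)
  (fun r => s * expR (L * r)) L _ t0).
- by move=> r; apply: cvg_mdist; [exact: continuous_flow|exact: cvg_cst].
- move=> r; have d2 := is_derive_expint L r.
  apply: is_derive_eq; rewrite /GRing.scale/=; ring.
- by rewrite flow0// mdistxx expint0r mulr0.
move=> r /andP[r0 _] Fr.
have F0 : 0 < mdist (flow x r) x.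
  by apply: le_lt_trans Fr; rewrite mulr_ge0// expint_ge0// ltW.
apply: (@dini_le_trans _ _ (L * mdist (flow x r) x + s)).
  have eE : expR (L * r) = 1 + L * E r by rewrite expintE; ring.
  by rewrite eE; lra.
move=> e e0.
(* This slack for the squared distance becomes [e] for the distance itself. *)
have e20 : 0 < 2 * mdist (flow x r) x * e by rewrite !mulr_gt0.
have dF := flow_dini Dx fx r0 e20.
have sl := slx _ (flow_in r Dx) (flow_Dom Dx r0).
near=> h.
have h0 : 0 < h by near: h; exact: nbhs_right_gt.
have := mdist_ge0 (flow x (r + h)) x.
have hd : mdist (flow x (r + h)) x ^+ 2 <= mdist (flow x r) x ^+ 2 +
   h * (L * mdist (flow x r) x ^+ 2 + 2 * (f x - f (flow x r)) +
     2 * mdist (flow x r) x * e) by near: h.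
move: hd sl F0; set F := mdist (flow x r) x; set G := mdist _ x.
move=> hd sl F0 G0.
have LF0 : 0 <= L * F := mulr_ge0 L0 (ltW F0).
have A0 : 0 <= h * (L * F + s + e).
  by apply: mulr_ge0; [exact: ltW|lra].
have FA0 : 0 <= F + h * (L * F + s + e) by lra.
rewrite -ler_sqr ?nnegrE//.
apply: le_trans hd _; rewrite sqrrD.
have := sqr_ge0 (h * (L * F + s + e)).
have := ler_wpM2l (ltW h0) sl.
lra.
Unshelve. all: by end_near. Qed.

(* The slope at [x] bounds both the displacement and the energy drop along
   the flow; feeding these into the EVI gains a second order term. *)
Lemma flow_EVI_slope x v s t : D x -> Dom phi x -> Dom phi v -> 0 <= s ->
  slope_le s x -> 0 <= t ->
  mdist (flow x t) v ^+ 2 <= expR (L * t) * mdist x v ^+ 2 +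
    2 * E t * (f v - f x) + s ^+ 2 * E t ^+ 2.
Proof.
move=> Dx fx fv s0 slx t0.
have L0 : 0 <= L by rewrite oppr_ge0.
set F0 := mdist x v ^+ 2; set A := f v - f x.
pose y r := expR (L * r) * F0 + 2 * E r * A + s ^+ 2 * E r ^+ 2.
apply: (@dini_comparison _ (fun r => mdist (flow x r) v ^+ 2) y
  (fun r => L * expR (L * r) * F0 + 2 * expR (L * r) * A +
     2 * s ^+ 2 * E r * expR (L * r)) L _ t0).
- exact: continuous_flow_sqdist.
- move=> r; have d1 := is_derive_expRM L r; have d2 := is_derive_expint L r.
  apply: is_derive_eq; rewrite /GRing.scale/=; ring.
- by rewrite /y flow0// mulr0 expR0 expint0r /F0; lra.
move=> r /andP[r0 _] _; apply: dini_le_trans (flow_dini Dx fv r0).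
have sl := slx _ (flow_in r Dx) (flow_Dom Dx r0).
have dr := flow_dist_le Dx fx s0 slx (ltW r0).
have d0 := mdist_ge0 (flow x r) x.
have sE := expint_ge0 L0 (ltW r0).
have drop : f x - f (flow x r) <= s * (s * E r) + L / 2 * (s * E r) ^+ 2.
  apply: le_trans sl _; apply: lerD; first by rewrite ler_wpM2l.
  by rewrite ler_wpM2l ?divr_ge0// ler_sqr ?nnegrE ?mulr_ge0.
have eE : expR (L * r) = 1 + L * E r by rewrite expintE; ring.
rewrite /y /A eE; lra.
Qed.

End EVIFlow.

(** * Distances to intermediate points *)

Section IntermediatePoints.
Context {R : realType} {X : metricType R}.

Lemma le_of_vanishing (a b c : R) : 0 <= c ->
  (forall th : R, 0 < th < 1 -> a <= b + th * c) -> a <= b.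
Proof.
move=> c0 abc; apply/ler_addgt0Pr => e e0.
pose th := Num.min 2^-1 (e / (c + 1)).
have th0 : 0 < th by rewrite lt_min invr_gt0 ltr0n/= divr_gt0//; lra.
have th1 : th < 1 by rewrite gt_min invf_lt1 ?ltr1n.
have the : th * (c + 1) <= e.
  by rewrite -ler_pdivlMr ?ge_min ?lexx ?orbT//; lra.
apply: le_trans (abc th _) _; first by rewrite th0.
by lra.
Qed.

Lemma le_of_sqr (a b : R) : 0 <= b -> a ^+ 2 <= b ^+ 2 -> a <= b.
Proof.
move=> b0 ab; rewrite leNgt; apply/negP => ba.
by move: ab; rewrite leNgt ltr_pXn2r ?ba ?nnegrE// (le_trans b0)// ltW.
Qed.

(** Since [q >= |d - p|] and [(1 - th) * p ^+ 2 + th * (d - p) ^+ 2 = (p - th * d) ^+ 2 + th * (1 -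
    th) * d ^+ 2], the distance [p] differs from [th * d] by at most [e * th * (1 - th) * d];
    symmetrically for [q]. *)
Lemma intermediate_point_dist (x0 x1 x : X) (th e : R) : 0 < th < 1 -> 0 <= e ->
  intermediate_point th e x0 x1 x ->
  mdist x0 x <= th * (1 + e) * mdist x0 x1 /\
  mdist x x1 <= (1 - th + e * th) * mdist x0 x1.
Proof.
move=> /andP[th0 th1] e0; rewrite /intermediate_point.
have := metric_triangle x0 x x1.
have := metric_triangle x0 x1 x; have := metric_triangle x x0 x1.
rewrite (mdist_sym x1 x) (mdist_sym x x0).
have := mdist_ge0 x0 x1; have := mdist_ge0 x0 x; have := mdist_ge0 x x1.
set d := mdist x0 x1; set p := mdist x0 x; set q := mdist x x1.
move=> q0 p0 d0 qpd pdq dpq.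
have th1' : 0 < 1 - th by lra.
have tt0 : 0 < th * (1 - th) by exact: mulr_gt0.
move=> /(ler_wpM2l (ltW tt0)).
have -> : th * (1 - th) * (p ^+ 2 / th + q ^+ 2 / (1 - th)) =
    (1 - th) * p ^+ 2 + th * q ^+ 2.
  by field; rewrite !gt_eqF.
move=> pq.
have k0 : 0 <= e * th * (1 - th) * d by rewrite !mulr_ge0 ?(ltW th0) ?(ltW th1').
have kd : e * th * (1 - th) * d <= e * th * d.
  have : 0 <= e * th * d * th by rewrite !mulr_ge0 ?(ltW th0).
  by lra.
have sq_le (a b : R) : - b <= a -> a <= b -> a ^+ 2 <= b ^+ 2.
  move=> ba ab; have b1 : 0 <= b + a by lra.
  have b2 : 0 <= b - a by lra.
  by have := mulr_ge0 b1 b2; lra.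
split.
- have : (d - p) ^+ 2 <= q ^+ 2 by apply: sq_le; lra.
  move=> /(ler_wpM2l (ltW th0)) dpq2.
  have : (p - th * d) ^+ 2 <= (e * th * (1 - th) * d) ^+ 2 by lra.
  by move=> /(le_of_sqr k0); lra.
- have : (d - q) ^+ 2 <= p ^+ 2 by apply: sq_le; lra.
  move=> /(ler_wpM2l (ltW th1')) dpq2.
  have : (q - (1 - th) * d) ^+ 2 <= (e * th * (1 - th) * d) ^+ 2 by lra.
  by move=> /(le_of_sqr k0); lra.
Qed.

End IntermediatePoints.

(** * Slope and energy estimates for the discrete movement *)

Section DiscreteSlope.
Context {R : realType} {X : metricType R} (phi : X -> \bar R) (D : set X)
  (lambda tau eta : R) (U : nat -> X).
Hypothesis phi_proper : proper_functional phi.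
Hypothesis lambda_le0 : lambda <= 0.
Hypothesis tau_gt0 : 0 < tau.
Hypothesis eta_ge0 : 0 <= eta.
Hypothesis U_D : forall n, (D `&` Dom phi) (U n).
Hypothesis U_MM : discrete_MM phi tau eta U.
Hypothesis phi_convex : approx_convex phi lambda D.

Local Notation f x := (fine (phi x)).
Local Notation L := (- lambda).
Local Notation step n := (mdist (U n.+1) (U n)).

(** With [eps = th] the errors of approximate convexity are of order [th ^+ 2] and vanish after
    division by [th]. *)
Lemma convex_point x0 x1 (th : R) : (D `&` Dom phi) x0 -> (D `&` Dom phi) x1 ->
  0 < th < 1 ->
  exists x, [/\ Dom phi x, mdist x0 x <= th * (1 + th) * mdist x0 x1,
    mdist x x1 <= (1 - th + th * th) * mdist x0 x1 &
    f x <= (1 - th) * f x0 + th * f x1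
      + (L + th) / 2 * th * (1 - th) * mdist x0 x1 ^+ 2].
Proof.
move=> Dx0 Dx1 th01; have [x [_ xm xc]] := phi_convex Dx0 Dx1 th01 th01.
have th0 : 0 <= th by case/andP: th01 => /ltW.
have [px qx] := intermediate_point_dist th01 th0 xm.
move: xc; rewrite -(fine_phiK phi_proper Dx0.2) -(fine_phiK phi_proper Dx1.2).
rewrite -!EFinM -EFinD /= => xc.
have fx : Dom phi x by apply: le_lt_trans xc _; rewrite ltry.
exists x; split=> //.
by move: xc; rewrite -(fine_phiK phi_proper fx) lee_fin /=; lra.
Qed.

Lemma MM_ineq n V : Dom phi V ->
  (2 * tau)^-1 * step n ^+ 2 + f (U n.+1) <=
  (2 * tau)^-1 * mdist V (U n) ^+ 2 + f V
    + eta / 2 * step n * mdist V (U n.+1).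
Proof.
move=> fV; have [_ /(_ n V fV) + _] := U_MM.
rewrite -(fine_phiK phi_proper fV) -(fine_phiK phi_proper (U_D n.+1).2).
by rewrite -!EFinD lee_fin /=.
Qed.

(** Minimality is tested a fraction [th] of the way to [V]. To first order the squared distance to
    [U n] grows by at most [2 * th * s * d], which yields [tau^-1]; the perturbation term yields
    [eta / 2]. *)
Lemma MM_slope n : slope_le phi D lambda ((tau^-1 + eta / 2) * step n) (U n.+1).
Proof.
move=> V DV fV; set d := mdist V _.
set s := step n.
have s0 : 0 <= s := mdist_ge0 _ _; have d0 : 0 <= d := mdist_ge0 _ _.
set i := tau^-1; have i0 : 0 < i by rewrite invr_gt0.
have sd0 : 0 <= s * d := mulr_ge0 s0 d0.
(* The constant collects the second order remainders. *)
apply: (@le_of_vanishing _ _ _ (2 * i * d ^+ 2 + (i + eta / 2) * (s * d)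
  + d ^+ 2 / 2)).
  have := mulr_ge0 (ltW i0) (sqr_ge0 d); have := mulr_ge0 (ltW i0) sd0.
  by have := mulr_ge0 eta_ge0 sd0; have := sqr_ge0 d; lra.
move=> th th01; have [x [fx px _ cx]] := convex_point (U_D n.+1) (conj DV fV) th01.
have [th0 th1] : 0 < th /\ th < 1 by apply/andP.
move: px cx (MM_ineq n fx); rewrite (mdist_sym x (U n.+1)) (mdist_sym (U n.+1) V).
have := metric_triangle x (U n.+1) (U n).
rewrite (mdist_sym x (U n.+1)) invfM -/d -/s -/i.
have := mdist_ge0 (U n.+1) x; have := mdist_ge0 x (U n).
set p := mdist (U n.+1) x; set m := mdist x (U n).
set f0 := f (U n.+1); set f1 := f V; set fx' := f x.
move=> m0 p0 mps pd cx mm.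
have p2 : p ^+ 2 <= 4 * th ^+ 2 * d ^+ 2.
  have -> : 4 * th ^+ 2 * d ^+ 2 = (2 * th * d) ^+ 2 by ring.
  rewrite ler_sqr ?nnegrE ?mulr_ge0 ?(ltW th0)//.
  apply: le_trans pd _; rewrite ler_wpM2r//.
  have : th * th <= th * 1 by rewrite ler_wpM2l ?(ltW th0) ?(ltW th1).
  lra.
have m2 : m ^+ 2 <= p ^+ 2 + 2 * p * s + s ^+ 2.
  have -> : p ^+ 2 + 2 * p * s + s ^+ 2 = (p + s) ^+ 2 by ring.
  by rewrite ler_sqr ?nnegrE ?addr_ge0.
have ps : p * s <= th * (1 + th) * (s * d) by have := ler_wpM2r s0 pd; lra.
rewrite -(ler_pM2l th0).
have {}m2 := ler_wpM2l (ltW i0) m2.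
have {}p2 := ler_wpM2l (ltW i0) p2.
have ps1 := ler_wpM2l (ltW i0) ps.
have ps2 := ler_wpM2l eta_ge0 ps.
have thd : (L + th) / 2 * th * (1 - th) * d ^+ 2 <= (L + th) / 2 * th * d ^+ 2.
  have Lth : 0 <= (L + th) / 2 by have := lambda_le0; lra.
  by have := mulr_ge0 Lth (sqr_ge0 (th * d)); lra.
by lra.
Qed.

(** Minimality is now tested towards [U n]. The leading coefficient [tau^-1] is twice that of the
    plain energy inequality, and the telescoping of the local errors rests on this gain. *)
Lemma MM_energy n :
  (tau^-1 - (L + eta) / 2) * step n ^+ 2 <= f (U n) - f (U n.+1).
Proof.
set s := step n.
have s0 : 0 <= s := mdist_ge0 _ _.
set i := tau^-1; have i0 : 0 < i by rewrite invr_gt0.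
apply: (@le_of_vanishing _ _ _ ((3 / 2 * i + 2^-1 + eta / 2) * s ^+ 2)).
  by rewrite mulr_ge0 ?sqr_ge0//; have := eta_ge0; lra.
move=> th th01; have [x [fx px qx cx]] := convex_point (U_D n.+1) (U_D n) th01.
have [th0 th1] : 0 < th /\ th < 1 by apply/andP.
move: px qx cx (MM_ineq n fx); rewrite (mdist_sym x (U n.+1)) invfM -/s -/i.
have := mdist_ge0 (U n.+1) x; have := mdist_ge0 x (U n).
set p := mdist (U n.+1) x; set q := mdist x (U n).
set f0 := f (U n.+1); set f1 := f (U n); set fx' := f x.
move=> q0 p0 ps qs cx mm.
have th2 : th * th <= th * 1 by rewrite ler_wpM2l ?(ltW th0) ?(ltW th1).
have q2 : q ^+ 2 <= (1 - 2 * th + 3 * th ^+ 2) * s ^+ 2.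
  apply: (@le_trans _ _ (((1 - th + th * th) * s) ^+ 2)).
    rewrite ler_sqr ?nnegrE// mulr_ge0//.
    by have := sqr_ge0 th; lra.
  rewrite exprMn ler_wpM2r ?sqr_ge0//.
  have := ler_wpM2l (sqr_ge0 th) th2; have := ler_wpM2l (ltW th0) th2.
  have : 0 <= th ^+ 3 by rewrite exprn_ge0 ?(ltW th0).
  lra.
have ps2 := ler_wpM2l eta_ge0 (ler_wpM2l s0 ps).
have {}q2 := ler_wpM2l (ltW i0) q2.
rewrite -(ler_pM2l th0).
have thd : (L + th) / 2 * th * (1 - th) * s ^+ 2 <= (L + th) / 2 * th * s ^+ 2.
  have Lth : 0 <= (L + th) / 2 by have := lambda_le0; lra.
  by have := mulr_ge0 Lth (sqr_ge0 (th * s)); lra.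
by lra.
Qed.

End DiscreteSlope.

(** * Discrete Gronwall and Cauchy-Schwarz inequalities *)

Section DiscreteGronwall.
Context {R : realType}.

(** Turns the loss [1 - gamma * tau] of one step into an exponential that can be iterated. *)
Lemma expRN2_le (y : R) : 0 <= y <= 4^-1 -> expR (- (2 * y)) <= 1 - y.
Proof.
move=> /andP[y0 y4]; rewrite expRN.
have e1 := expR_ge1Dx (2 * y); have e0 := expR_gt0 (2 * y).
have yy : y * y <= y * 4^-1 by rewrite ler_wpM2l.
have y1 : 0 <= 1 - y by lra.
rewrite -(ler_pM2l e0) mulfV ?gt_eqF//.
by have := ler_wpM2r y1 e1; lra.
Qed.

(** Inductive step of Cauchy-Schwarz for a sum of [m + 1] terms, by the arithmetic-geometric mean
    inequality for [a] and [m * b]. *)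
Lemma sqrtM_addr_le (m a b : R) : 0 <= m -> 0 <= a -> 0 <= b ->
  Num.sqrt (m * a) + Num.sqrt b <= Num.sqrt ((m + 1) * (a + b)).
Proof.
move=> m0 a0 b0.
have ma0 := mulr_ge0 m0 a0; have mb0 := mulr_ge0 m0 b0.
apply: le_of_sqr; first exact: sqrtr_ge0.
rewrite sqr_sqrtr; last by rewrite mulr_ge0// addr_ge0.
rewrite sqrrD !sqr_sqrtr// -sqrtrM//.
have -> : m * a * b = a * (m * b) by ring.
rewrite sqrtrM//.
have := sqr_ge0 (Num.sqrt a - Num.sqrt (m * b)).
by rewrite sqrrB !sqr_sqrtr//; lra.
Qed.

(* With [Z m := expR (- (2 * y)) ^+ m * D m ^+ 2] the errors telescope under
   Cauchy-Schwarz: [err m] is at most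
   [B * expR (m * y) * sqrt (Z m - Z m.+1)]. *)
Lemma discrete_gronwall (d D err : nat -> R) (y B : R) :
  0 <= y -> 0 < B -> (forall n, 0 <= d n) -> (forall n, 0 <= D n) ->
  (forall n, 0 <= err n) ->
  (forall n, d n.+1 <= expR y * d n + err n) ->
  (forall n, err n ^+ 2 <= B ^+ 2 * (D n ^+ 2 - expR (- (2 * y)) * D n.+1 ^+ 2)) ->
  forall m, d m <= expR (m%:R * y) * (d 0%N + B * Num.sqrt m%:R * D 0%N).
Proof.
move=> y0 B0 d0 D0 err0 dS errS.
pose Z m := expR (- (2 * (m%:R * y))) * D m ^+ 2.
have Z0 m : 0 <= Z m by rewrite mulr_ge0 ?expR_ge0 ?sqr_ge0.
have errZ m : err m ^+ 2 <= (B * expR (m%:R * y)) ^+ 2 * (Z m - Z m.+1).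
  apply: le_trans (errS m) _; rewrite exprMn -[leRHS]mulrA ler_pM2l ?exprn_gt0//.
  rewrite mulrBr.
  have -> : expR (m%:R * y) ^+ 2 * Z m = D m ^+ 2.
    rewrite /Z mulrA -expRM_natl -expRD.
    by have -> : 2%:R * (m%:R * y) + - (2 * (m%:R * y)) = 0; [ring|rewrite expR0 mul1r].
  have -> // : expR (m%:R * y) ^+ 2 * Z m.+1 = expR (- (2 * y)) * D m.+1 ^+ 2.
  by rewrite /Z mulrA -expRM_natl -expRD -natr1; congr (expR _ * _); ring.
have Be m : 0 < B * expR (m%:R * y) by rewrite mulr_gt0 ?expR_gt0.
have ZS m : 0 <= Z m - Z m.+1.
  have := le_trans (sqr_ge0 _) (errZ m).
  by rewrite pmulr_rge0// exprn_gt0.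
have Z0m m : Z m <= Z 0%N.
  elim: m => // m IH; apply: le_trans IH.
  by rewrite -subr_ge0.
have main m : d m <= expR (m%:R * y) *
    (d 0%N + B * Num.sqrt (m%:R * (Z 0%N - Z m))).
  elim: m => [|m IH].
    by rewrite !mul0r expR0 sqrtr0 mulr0 addr0 mul1r.
  apply: le_trans (dS m) _.
  have err_le : err m <= B * expR (m%:R * y) * Num.sqrt (Z m - Z m.+1).
    apply: le_of_sqr; first by rewrite mulr_ge0 ?sqrtr_ge0 ?(ltW (Be m)).
    by rewrite [leRHS]exprMn sqr_sqrtr.
  have eS : expR (m.+1%:R * y) = expR y * expR (m%:R * y).
    by rewrite -expRD -natr1; congr expR; ring.
  have ey : 1 <= expR y by rewrite -expR0 ler_expR.
  have s0 : 0 <= Z 0%N - Z m by rewrite subr_ge0.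
  have sum_le := sqrtM_addr_le (ler0n R m) s0 (ZS m).
  have zE : Z 0%N - Z m + (Z m - Z m.+1) = Z 0%N - Z m.+1 by ring.
  rewrite zE natr1 in sum_le.
  have q0 := sqrtr_ge0 (Z m - Z m.+1).
  have errE : err m <= expR y * (B * expR (m%:R * y) * Num.sqrt (Z m - Z m.+1)).
    apply: le_trans err_le _; rewrite -[leLHS]mul1r ler_wpM2r//.
    by rewrite mulr_ge0 ?(ltW (Be m)).
  have := ler_wpM2l (expR_ge0 y) IH.
  have := ler_wpM2l (mulr_ge0 (expR_ge0 y) (ltW (Be m))) sum_le.
  by rewrite eS; lra.
move=> m; apply: le_trans (main m) _.
rewrite ler_wpM2l ?expR_ge0// lerD2l -mulrA ler_wpM2l ?(ltW B0)//.
rewrite sqrtrM ?ler0n// ler_wpM2l ?sqrtr_ge0//.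
rewrite -[leRHS]ger0_norm// -sqrtr_sqr ler_wsqrtr//.
rewrite {1}/Z mul0r mulr0 oppr0 expR0 mul1r.
by rewrite gerBl.
Qed.

Lemma exists_le_average (a : nat -> R) k :
  exists2 i, (i <= k)%N & k.+1%:R * a i <= \sum_(n < k.+1) a n.
Proof.
elim: k => [|k [i ik IH]]; first by exists 0%N => //; rewrite big_ord1 mul1r.
rewrite big_ord_recr/= -natr1.
have k0 : 0 <= k.+1%:R :> R by exact: ler0n.
have [ai|ai] := leP (a i) (a k.+1).
  by exists i; [exact: leqW|rewrite mulrDl mul1r lerD].
exists k.+1 => //; rewrite mulrDl mul1r lerD2r.
by apply: le_trans IH; rewrite ler_wpM2l// ltW.
Qed.

Lemma sqdist_path_le {X : metricType R} (U : nat -> X) j :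
  mdist (U j) (U 0%N) ^+ 2 <= j%:R * \sum_(n < j) mdist (U n.+1) (U n) ^+ 2.
Proof.
elim: j => [|j IH]; first by rewrite mdistxx expr0n mul0r.
rewrite big_ord_recr/= -natr1; set S := \sum_(i < j) _ in IH *.
set s := mdist (U j.+1) (U j); set p := mdist (U j) (U 0%N) in IH *.
have s0 : 0 <= s := mdist_ge0 _ _.
have p0 : 0 <= p := mdist_ge0 _ _.
have S0 : 0 <= S by apply: sumr_ge0 => i _; exact: sqr_ge0.
have j0 : 0 <= j%:R :> R by exact: ler0n.
have := sqrtM_addr_le j0 S0 (sqr_ge0 s).
rewrite sqrtr_sqr ger0_norm// => cs.
have pS : p <= Num.sqrt (j%:R * S).
  by rewrite -[p]ger0_norm// -sqrtr_sqr ler_wsqrtr.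
rewrite -[leRHS]sqr_sqrtr; last by rewrite mulr_ge0 ?addr_ge0 ?sqr_ge0.
rewrite ler_sqr ?nnegrE ?sqrtr_ge0 ?mdist_ge0//.
have := metric_triangle (U j.+1) (U j) (U 0%N).
by rewrite -/s -/p; lra.
Qed.

(* [l], [n] and [k] stand for [- lambda * tau], [eta * tau] and
   [expint (- lambda) tau / tau]. *)
Lemma step_coefficient (l n k : R) : 0 <= l -> 0 <= n -> 2 * n + 3 * l <= 4^-1 ->
  1 <= k -> k * (2 - l) <= 2 ->
  (1 - (2 * n + 3 * l)) * (k * (1 + n / 2)) ^+ 2 <= 2 * k - 1 - k * (2 * l + n).
Proof.
move=> l0 n0 nl k1 k2.
pose dl := k - 1.
have kE : k = 1 + dl by rewrite /dl; ring.
have dl0 : 0 <= dl by rewrite /dl; lra.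
(* The bound on [k] reads [2 * (k - 1) <= k * l], and [k <= 2]. *)
have dll : dl <= l.
  have : k <= 2 by have := ler_wpM2l (ler0n R 1) k2; nra.
  by move=> kk; have := ler_wpM2r l0 kk; rewrite /dl; lra.
have h1 : (1 - (2 * n + 3 * l)) * (1 + n / 2) ^+ 2 <= 1 - n - 3 * l.
  have n2 := mulr_ge0 n0 n0; have n3 := mulr_ge0 n2 n0.
  have l1 := mulr_ge0 l0 n0; have l2 := mulr_ge0 l0 n2.
  by rewrite expr2; lra.
have k20 : 0 <= k ^+ 2 by exact: sqr_ge0.
rewrite exprMn.
have := ler_wpM2r k20 h1.
have dd : dl * dl <= l * 1 by apply: ler_pM => //; lra.
have x1 := mulr_ge0 dl0 l0; have x2 := mulr_ge0 dl0 n0.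
have x3 := mulr_ge0 dl0 x1; have x4 := mulr_ge0 dl0 x2.
by rewrite kE; lra.
Qed.

End DiscreteGronwall.

(** * Error between the flow and the discrete movement, both from [U 0] *)

Section ErrorEstimate.
Context {R : realType} {X : metricType R} (phi : X -> \bar R) (D : set X)
  (lambda tau eta : R) (S : R -> X -> X) (U : nat -> X).
Hypothesis phi_proper : proper_functional phi.
Hypothesis phi_lsc : lower_semicontinuous phi.
Hypothesis lambda_le0 : lambda <= 0.
Hypothesis S_flow : EVI_gradient_flow phi lambda D S.
Hypothesis tau_gt0 : 0 < tau.
Hypothesis eta_ge0 : 0 <= eta.
Local Notation gamma := (2 * eta - 3 * lambda).
Hypothesis tau_small : 4 * gamma * tau <= 1.
Hypothesis U_D : forall n, (D `&` Dom phi) (U n).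
Hypothesis U_MM : discrete_MM phi tau eta U.
Hypothesis phi_convex : approx_convex phi lambda D.

Local Notation f x := (fine (phi x)).
Local Notation L := (- lambda).
Local Notation E := (expint L).
Local Notation step n := (mdist (U n.+1) (U n)).

Let L0 : 0 <= L. Proof. by rewrite oppr_ge0. Qed.
Let l0 : 0 <= L * tau. Proof. by rewrite mulr_ge0 ?(ltW tau_gt0). Qed.
Let n0 : 0 <= eta * tau. Proof. by rewrite mulr_ge0 ?(ltW tau_gt0). Qed.
Let yE : gamma * tau = 2 * (eta * tau) + 3 * (L * tau). Proof. ring. Qed.
Let y0 : 0 <= gamma * tau.
Proof. by rewrite yE; have := n0; have := l0; lra. Qed.
Let y4 : 2 * (eta * tau) + 3 * (L * tau) <= 4^-1.
Proof. by have := tau_small; rewrite -mulrA yE; lra. Qed.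

(** [flow_EVI_slope] from [U n.+1] tested at [U n.+2], with the energy difference replaced by
    [MM_energy]. By [step_coefficient] the two squared steps then form the difference that
    [discrete_gronwall] telescopes. *)
Lemma MM_local_error n :
  mdist (flow S (U n.+1) tau) (U n.+2) ^+ 2 <=
  (6 / 5) ^+ 2 * (step n ^+ 2 - expR (- (2 * (gamma * tau))) * step n.+1 ^+ 2).
Proof.
have i0 : 0 < tau^-1 by rewrite invr_gt0.
have s0 : 0 <= (tau^-1 + eta / 2) * step n.
  by rewrite mulr_ge0 ?mdist_ge0// addr_ge0 ?divr_ge0 ?(ltW i0).
have := flow_EVI_slope phi_proper lambda_le0 S_flow (U_D n.+1).1 (U_D n.+1).2
  (U_D n.+2).2 s0 (MM_slope phi_proper lambda_le0 tau_gt0 eta_ge0 U_D U_MM phi_convex n)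
  (ltW tau_gt0).
have := MM_energy phi_proper lambda_le0 tau_gt0 eta_ge0 U_D U_MM phi_convex n.+1.
rewrite (mdist_sym (U n.+1) (U n.+2)).
have -> : expR (L * tau) = 1 + L * E tau by rewrite expintE; ring.
set b := mdist (U n.+2) (U n.+1); set c := mdist (U n.+1) (U n).
set err := mdist (flow _ _ _) _.
set l := L * tau; set m := eta * tau.
pose k := E tau / tau.
have tau0 : tau != 0 by rewrite gt_eqF.
have -> : E tau = k * tau by rewrite /k divfK.
have E0 : 0 <= E tau by rewrite expint_ge0// ltW.
have k1 : 1 <= k by rewrite ler_pdivlMr// mul1r expint_ge.
have k2 : k * (2 - l) <= 2.
  rewrite -(ler_pM2r tau_gt0).
  have -> : k * (2 - l) * tau = E tau * (2 - l) by rewrite /k; field.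
  by apply: expint_pade => //; exact: ltW.
have coef := step_coefficient l0 n0 y4 k1 k2.
move=> en er.
pose B := k * (1 + m / 2).
have B1 : 1 <= B.
  by rewrite -[leLHS]mulr1; apply: ler_pM => //; have := n0; rewrite -/m; lra.
(* The smallness of [tau] forces [l <= 1/12] and [m <= 1/8]. *)
have B65 : B <= 6 / 5.
  have k24 : k <= 24 / 23.
    have : k * (2 - 12^-1) <= k * (2 - l).
      by rewrite ler_wpM2l//; have := y4; have := n0; rewrite -/l -/m; lra.
    lra.
  apply: (@le_trans _ _ (24 / 23 * (17 / 16))); last by lra.
  apply: ler_pM => //; have := y4; have := n0; have := l0; rewrite -/l -/m; lra.
have b0 : 0 <= b ^+ 2 by exact: sqr_ge0.
have {}er : err ^+ 2 <= B ^+ 2 * c ^+ 2 - (2 * k - 1 - k * (2 * l + m)) * b ^+ 2.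
  have kt0 : 0 <= 2 * (k * tau) by rewrite !mulr_ge0 ?(ltW tau_gt0)//; lra.
  have := ler_wpM2l kt0 en.
  have -> : 2 * (k * tau) * ((tau^-1 - (L + eta) / 2) * b ^+ 2) =
    (2 * k - k * (l + m)) * b ^+ 2 by rewrite /l /m; field.
  move: er.
  have -> : ((tau^-1 + eta / 2) * c) ^+ 2 * (k * tau) ^+ 2 = B ^+ 2 * c ^+ 2.
    by rewrite /B /m; field.
  have -> : L * (k * tau) = k * l by rewrite /l; ring.
  by lra.
have y14 : 0 <= gamma * tau <= 4^-1 by rewrite y0 yE y4.
have rho := expRN2_le y14.
have {}er : err ^+ 2 <=
    B ^+ 2 * (c ^+ 2 - expR (- (2 * (gamma * tau))) * b ^+ 2).
  have := ler_wpM2r b0 coef; rewrite -/B.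
  have := ler_wpM2l (sqr_ge0 B) (ler_wpM2r b0 rho); rewrite yE -/l -/m.
  by lra.
have B20 : 0 < B ^+ 2 by rewrite exprn_gt0//; lra.
(* The difference is nonnegative because [err ^+ 2] is, so [B] may be enlarged to [6 / 5]. *)
have := le_trans (sqr_ge0 _) er; rewrite (pmulr_rge0 _ B20) => c0.
apply: le_trans er _; apply: ler_wpM2r => //.
by rewrite ler_sqr ?nnegrE//; lra.
Qed.

(** Over one step the flow from [U 0] is compared by contraction with the flow restarted at the
    current discrete point. The count starts at [i.+1] because [MM_slope] bounds the slope only
    after a first step. *)
Lemma MM_flow_dist i m :
  mdist (flow S (U 0%N) ((i.+1 + m)%:R * tau)) (U (i.+1 + m)) <=
  expR (m%:R * (gamma * tau)) *
   (mdist (flow S (U 0%N) (i.+1%:R * tau)) (U i.+1) +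
    6 / 5 * Num.sqrt m%:R * step i).
Proof.
have D0 := (U_D 0).1.
have ntau (n : nat) : 0 <= n%:R * tau by rewrite mulr_ge0 ?(ltW tau_gt0).
pose d n := mdist (flow S (U 0%N) ((i.+1 + n)%:R * tau)) (U (i.+1 + n)).
pose s n := step (i + n).
pose err n := mdist (flow S (U (i + n).+1) tau) (U (i + n).+2).
have := @discrete_gronwall R d s err (gamma * tau) (6 / 5).
rewrite /d /s !addn0; apply.
- exact: y0.
- by lra.
- by move=> n; exact: mdist_ge0.
- by move=> n; exact: mdist_ge0.
- by move=> n; exact: mdist_ge0.
- move=> n; rewrite addnS !addSn -natr1 mulrDl mul1r.
  rewrite (flowD S_flow) ?(ltW tau_gt0)//.
  apply: le_trans (metric_triangle _ (flow S (U (i + n).+1) tau) _) _.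
  rewrite lerD2r.
  apply: le_trans (flow_contraction phi_proper phi_lsc lambda_le0 S_flow
    (flow_in S_flow _ D0) (U_D _).1 (ltW tau_gt0)) _.
  rewrite ler_wpM2r ?mdist_ge0// ler_expR yE.
  by have := l0; have := n0; lra.
- by move=> n; rewrite addnS; exact: MM_local_error.
Qed.

Lemma MM_energy_sum j : 15 / 16 * \sum_(n < j) step n ^+ 2 <=
  tau * (f (U 0%N) - f (U j)).
Proof.
elim: j => [|j IH]; first by rewrite big_ord0 mulr0 subrr mulr0.
rewrite big_ord_recr/=.
have := MM_energy phi_proper lambda_le0 tau_gt0 eta_ge0 U_D U_MM phi_convex j.
move=> /(ler_wpM2l (ltW tau_gt0)).
have tau0 : tau != 0 by rewrite gt_eqF.
have -> : tau * ((tau^-1 - (L + eta) / 2) * step j ^+ 2) =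
  (1 - (L * tau + eta * tau) / 2) * step j ^+ 2 by field.
(* The smallness of [tau] gives [L * tau + eta * tau <= 1/8]. *)
have : 15 / 16 <= 1 - (L * tau + eta * tau) / 2.
  by have := y4; have := l0; have := n0; lra.
move=> /(ler_wpM2r (sqr_ge0 (step j))).
by lra.
Qed.

Section Regularized.
Variables (sigma Q : R).
Hypothesis sigma_gt0 : 0 < sigma.
Hypothesis Q_ge0 : 0 <= Q.
(** The defining bound of the Moreau-Yosida regularization, with [Q] in the role of
    [phi (U 0) - phi_sigma (U 0)]. *)
Hypothesis energy_drop : forall V, Dom phi V ->
  f (U 0%N) - f V <= Q + (2 * sigma)^-1 * mdist V (U 0%N) ^+ 2.

(** The EVI is tested at [U 0] itself; the quadratic part of [energy_drop] is absorbed on the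
    left. *)
Lemma flow_start_dist r c : 0 <= r -> E r <= c * sigma ->
  (1 - c) * mdist (flow S (U 0%N) r) (U 0%N) ^+ 2 <= 2 * E r * Q.
Proof.
move=> r0 Ec; have [D0 f0] := U_D 0.
have := flow_EVI_integral phi_proper phi_lsc S_flow D0 f0 r0.
have := energy_drop (flow_Dom_ge0 S_flow D0 f0 r0).
rewrite mdistxx expr0n mulr0 add0r; set d2 := _ ^+ 2.
have d0 : 0 <= d2 := sqr_ge0 _.
have E0 : 0 <= E r by exact: expint_ge0.
have E20 : 0 <= 2 * E r by exact: mulr_ge0.
move=> /(ler_wpM2l E20) h1 h2.
have : E r / sigma * d2 <= c * d2 by rewrite ler_wpM2r// ler_pdivrMr.
move: h1; rewrite invfM; lra.
Qed.

(** The path length and the energy sum bound each other. As [j * tau <= sigma / 2], only [p2 / 4]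
    returns and is absorbed; [15/16 - 1/4 = 11/16] explains the denominators. *)
Lemma MM_start_dist j : 2 * (j%:R * tau) <= sigma ->
  mdist (U j) (U 0%N) ^+ 2 <= 8 / 11 * sigma * Q /\
  \sum_(n < j) step n ^+ 2 <= 16 / 11 * tau * Q.
Proof.
move=> js; have := MM_energy_sum j; have := sqdist_path_le U j.
have := energy_drop (U_D j).2.
have j0 : 0 <= j%:R :> R := ler0n _ _.
set p2 := mdist _ _ ^+ 2; set Sj := \sum_(n < j) _.
have p0 : 0 <= p2 := sqr_ge0 _.
move=> /(ler_wpM2l (ltW tau_gt0)) drop pS sumS.
have drop2 : 15 / 16 * Sj <= tau * Q + tau / sigma * p2 / 2.
  by apply: le_trans sumS _; apply: le_trans drop _; rewrite invfM; lra.
have jt : j%:R * tau <= sigma / 2 by lra.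
have ts0 : 0 <= tau / sigma by rewrite divr_ge0 ?(ltW tau_gt0) ?(ltW sigma_gt0).
have jts : j%:R * (tau / sigma) <= 2^-1 by rewrite mulrA ler_pdivrMr//; lra.
have pQ : 15 / 16 * p2 <= sigma / 2 * Q + p2 / 4.
  have := ler_wpM2l j0 drop2.
  have := ler_wpM2r Q_ge0 jt; have := ler_wpM2r p0 jts.
  by lra.
have pq : p2 <= 8 / 11 * sigma * Q by lra.
split=> //.
have := ler_wpM2l ts0 pq.
have -> : tau / sigma * (8 / 11 * sigma * Q) = 8 / 11 * tau * Q.
  by field; rewrite gt_eqF.
by lra.
Qed.

(** With [w = sqrt (T * Q)] the error is at most [(7/2 + 3/2 + 17/10 + 11/5) * w * W]: flow and
    movement up to index [i.+1], propagated local errors, and the gap between [t] and [N * tau]. *)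
Lemma error_estimate (N : nat) (t : R) :
  0 <= t -> t <= N%:R * tau -> N%:R * tau - t <= tau -> (0 < N)%N ->
  let T := Num.sqrt (tau * (N%:R * tau)) in
  2 * tau <= sigma -> sigma <= 3 * T -> L * sigma <= 1 ->
  3 * T <= sigma * expR ((L + eta) * (3 * T)) ->
  mdist (flow S (U 0%N) t) (U N) <=
    10 * Num.sqrt T * expR (2 * gamma * (N%:R * tau)) * Num.sqrt Q.
Proof.
move=> t0 tN Nt N0 T s2 s3 Ls sT.
have tau0 := ltW tau_gt0; have sg0 := ltW sigma_gt0.
have NR1 : 1 <= N%:R :> R by rewrite ler1n.
have NR0 : 0 <= N%:R :> R := ler0n _ _.
have T0 : 0 <= T := sqrtr_ge0 _.
have T2 : T ^+ 2 = N%:R * tau ^+ 2.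
  by rewrite sqr_sqrtr; [ring|rewrite !mulr_ge0].
have T_gt0 : 0 < T.
  by rewrite sqrtr_gt0 !mulr_gt0// ltr0n.
have tauT : tau <= T.
  apply: le_of_sqr => //; rewrite T2.
  by have := ler_wpM2r (sqr_ge0 tau) NR1; rewrite mul1r.
have TN : T <= N%:R * tau.
  apply: le_of_sqr; first by rewrite mulr_ge0.
  rewrite T2 exprMn ler_wpM2r ?sqr_ge0// expr2.
  by rewrite -[leLHS]mulr1 ler_wpM2l.
(* The largest number of steps that fits into [sigma / 2]. *)
have [k [kl ku]] : exists k : nat, 2 * (k%:R * tau) <= sigma /\
    sigma < 2 * (k.+1%:R * tau).
  have q0 : 0 <= sigma / (2 * tau) by rewrite divr_ge0 ?mulr_ge0.
  have t20 : 0 < 2 * tau by rewrite mulr_gt0.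
  have := truncn_itv q0; rewrite ler_pdivlMr// ltr_pdivrMr// => /andP[a b].
  by exists (Num.truncn (sigma / (2 * tau))); split; lra.
have k1 : (0 < k)%N.
  rewrite lt0n; apply/eqP => k0; move: ku; rewrite k0.
  by lra.
(* Otherwise [2 * (N + 1) <= 3 * sqrt N], which is impossible. *)
have kN : (k <= N)%N.
  rewrite leqNgt; apply/negP => Nk.
  have kr : N%:R + 1 <= k%:R :> R by rewrite natr1 ler_nat.
  have h1 : 2 * (N%:R + 1) * tau <= 3 * T.
    by have := ler_wpM2r tau0 kr; lra.
  have : (2 * (N%:R + 1) * tau) ^+ 2 <= (3 * T) ^+ 2.
    by rewrite ler_sqr ?nnegrE ?mulr_ge0 ?addr_ge0.
  rewrite !exprMn T2 [leRHS]mulrA ler_pM2r ?exprn_gt0//.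
  by have := sqr_ge0 (N%:R - 1 : R); lra.
case: k k1 kl ku kN => // k _ kl ku kN.
have [i ik si] := exists_le_average (fun n => step n ^+ 2) k.
have [_ Sk] := MM_start_dist kl.
have iN : (i < N)%N by rewrite (leq_ltn_trans ik).
have il : 2 * (i.+1%:R * tau) <= sigma.
  apply: le_trans kl; rewrite ler_pM2l// ler_pM2r// ler_nat.
  by rewrite ltnS.
have [pj _] := MM_start_dist il.
set w := Num.sqrt (T * Q).
have w0 : 0 <= w := sqrtr_ge0 _.
have w2 : w ^+ 2 = T * Q by rewrite sqr_sqrtr// mulr_ge0.
have TQ0 : 0 <= T * Q by exact: mulr_ge0.
have sTQ : sigma * Q <= 3 * (T * Q) by have := ler_wpM2r Q_ge0 s3; lra.
have p_le : mdist (U i.+1) (U 0%N) <= 3 / 2 * w.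
  by apply: le_of_sqr; [lra|rewrite exprMn w2; lra].
have r0 : 0 <= i.+1%:R * tau by rewrite mulr_ge0.
have g_le : mdist (flow S (U 0%N) (i.+1%:R * tau)) (U 0%N) <= 7 / 2 * w.
  apply: le_of_sqr; first by lra.
  (* The squared distance is then at most [4 * sigma * Q <= 12 * w ^+ 2], and [12 <= (7/2) ^+ 2]. *)
  have Er : E (i.+1%:R * tau) <= 2 / 3 * sigma.
    have E0 := expint_ge0 L0 r0.
    have Lr : L * (i.+1%:R * tau) <= 2^-1.
      have rs : i.+1%:R * tau <= sigma / 2 by lra.
      by have := ler_wpM2l L0 rs; lra.
    have := expint_pade L0 r0; have := ler_wpM2l E0 Lr; lra.
  have := flow_start_dist r0 Er; have := ler_wpM2r Q_ge0 Er.
  by rewrite exprMn w2; lra.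
have h0 : 0 <= N%:R * tau - t by rewrite subr_ge0.
have h_le : mdist (flow S (U 0%N) (N%:R * tau - t)) (U 0%N) <= 11 / 5 * w.
  apply: le_of_sqr; first by lra.
  set h := N%:R * tau - t in h0 Nt *.
  have E0 := expint_ge0 L0 h0.
  have Et : E h <= 24 / 23 * tau.
    have Lh : L * h <= 12^-1.
      by have := ler_wpM2l L0 Nt; have := y4; have := n0; lra.
    have := expint_pade L0 h0; have := ler_wpM2l E0 Lh; lra.
  have Es : E h <= 12 / 23 * sigma by lra.
  have := flow_start_dist h0 Es; have := ler_wpM2r Q_ge0 Et.
  have := ler_wpM2r Q_ge0 tauT.
  by rewrite exprMn w2; lra.
set W := expR (2 * gamma * (N%:R * tau)).
(* Half the exponent relating [sigma] to [3 * T], because [sigma^-1] enters the error under a square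
   root. *)
set A := (L + eta) * (3 * T) / 2.
have aT0 : 0 <= A by rewrite /A divr_ge0// !mulr_ge0// addr_ge0.
have s_le : 6 / 5 * Num.sqrt N%:R * step i <= 17 / 10 * expR A * w.
  apply: le_of_sqr; first by rewrite !mulr_ge0 ?expR_ge0.
  rewrite !exprMn sqr_sqrtr// w2.
  have -> : expR A ^+ 2 = expR ((L + eta) * (3 * T)).
    by rewrite -expRM_natl; congr expR; rewrite /A; field.
  set e := expR _ in sT *.
  have st2 : step i ^+ 2 * (sigma / 4) <= 16 / 11 * tau ^+ 2 * Q.
    have ks : sigma / 4 <= k.+1%:R * tau.
      have : 1 <= k.+1%:R :> R by rewrite ler1n.
      move=> /(ler_wpM2r tau0); rewrite mul1r.
      by move: ku; rewrite -[k.+2%:R]natr1; lra.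
    have := ler_wpM2l (sqr_ge0 (step i)) ks.
    have := ler_wpM2l tau0 (le_trans si Sk); lra.
  have := ler_wpM2l NR0 st2.
  have : N%:R * (step i ^+ 2) * (3 * T) <= N%:R * step i ^+ 2 * (sigma * e).
    by rewrite ler_wpM2l// mulr_ge0 ?sqr_ge0.
  have e0 : 0 <= e := expR_ge0 _.
  move=> h1 h2; have {}h2 := ler_wpM2r e0 h2.
  rewrite -(ler_pM2r T_gt0).
  have TTQ : 0 <= T * T * Q * e by rewrite !mulr_ge0.
  have TE : N%:R * (16 / 11 * tau ^+ 2 * Q) = 16 / 11 * (T * T) * Q.
    by rewrite -expr2 T2; ring.
  rewrite TE in h2.
  by lra.
have gN : gamma * (N%:R * tau) = N%:R * (gamma * tau) by ring.
have Ng0 : 0 <= N%:R * (gamma * tau).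
  by rewrite mulr_ge0// y0.
have W1 : expR (L * t) <= W.
  rewrite ler_expR -mulrA gN.
  have := ler_wpM2l L0 tN.
  have := mulr_ge0 NR0 l0; have := mulr_ge0 NR0 n0.
  rewrite yE; lra.
(* One factor [expR (gamma * (N * tau))] pays for [expR A], another for the propagation [V]; hence
   [2 * gamma] in [W]. *)
have AW : A <= N%:R * (gamma * tau).
  rewrite /A.
  have a0 : 0 <= (L + eta) * 3 / 2 by rewrite divr_ge0// mulr_ge0// addr_ge0.
  have := ler_wpM2l a0 TN; have := mulr_ge0 NR0 l0; have := mulr_ge0 NR0 n0.
  rewrite yE; lra.
have mN : (N - i.+1)%:R * (gamma * tau) <= N%:R * (gamma * tau).
  by rewrite ler_wpM2r ?ler_nat ?leq_subr// y0.
set V := expR ((N - i.+1)%:R * (gamma * tau)).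
have V0 : 0 <= V := expR_ge0 _.
have V1 : V <= W by rewrite ler_expR -mulrA gN; lra.
have V2 : V * expR A <= W by rewrite -expRD ler_expR -mulrA gN; lra.
have := MM_flow_dist i (N - i.+1).
rewrite subnKC// -/V => hMM.
have hsqrt : 6 / 5 * Num.sqrt (N - i.+1)%:R * step i <= 6 / 5 * Num.sqrt N%:R * step i.
  rewrite ler_wpM2r ?mdist_ge0// ler_wpM2l//.
  by rewrite ler_wsqrtr// ler_nat leq_subr.
have hg : mdist (flow S (U 0%N) (i.+1%:R * tau)) (U i.+1) <= 5 * w.
  apply: le_trans (metric_triangle _ (U 0%N) _) _.
  by rewrite (mdist_sym (U 0%N)); lra.
have first : mdist (flow S (U 0%N) (N%:R * tau)) (U N) <= 5 * w * W + 17 / 10 * w * W.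
  apply: le_trans hMM _.
  have h1 := ler_wpM2l V0 (lerD hg (le_trans hsqrt s_le)).
  have := ler_wpM2r w0 V1; have := ler_wpM2r w0 V2; lra.
have second : mdist (flow S (U 0%N) t) (flow S (U 0%N) (N%:R * tau)) <=
    11 / 5 * w * W.
  have [D0 _] := U_D 0.
  (* Running the gap first places it at [U 0], where [energy_drop] controls it; contraction carries
     it over time [t]. *)
  have -> : N%:R * tau = (N%:R * tau - t) + t by rewrite subrK.
  rewrite (flowD S_flow)//.
  apply: le_trans (flow_contraction phi_proper phi_lsc lambda_le0 S_flow
    D0 (flow_in S_flow _ D0) t0) _.
  rewrite mdist_sym mulrC ler_pM ?mdist_ge0 ?expR_ge0//.
apply: le_trans (metric_triangle _ (flow S (U 0%N) (N%:R * tau)) _) _.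
have -> : 10 * Num.sqrt T * W * Num.sqrt Q = 10 * w * W.
  by rewrite /w sqrtrM//; ring.
have : 0 <= w * W by rewrite mulr_ge0 ?expR_ge0.
by lra.
Qed.

End Regularized.

End ErrorEstimate.

(** * Bounds on [sigma], an exponential integral with negative rate *)

Section ExpDecay.
Context {R : realType}.
Implicit Types a x tau : R.

Lemma expintN_mul_le1 a x : a * expint (- a) x <= 1.
Proof.
have := expintE (- a) x; have := expR_gt0 (- a * x).
by rewrite mulNr; lra.
Qed.

(** The right-hand side equals [expint a x]. *)
Lemma le_expintN_expR a x : 0 <= a -> x <= expint (- a) x * expR (a * x).
Proof.
move=> a0; apply: le_trans (expint_ge x a0) _; move: a0.
rewrite le_eqVlt => /predU1P[<-|a0].
  by rewrite oppr0 mul0r expR0 mulr1.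
rewrite -(ler_pM2l a0) expintE mulrA.
have -> : a * expint (- a) x = 1 - expR (- a * x).
  by have := expintE (- a) x; lra.
by rewrite mulrBl mul1r -expRD mulNr addNr expR0.
Qed.

(** Ensures that a full step fits into [sigma / 2]. With [z = 3 * a * tau <= 1/2], the bound [expR
    (- z) <= (1 + z)^-1 <= 1 - 2 / 3 * z] leaves exactly [a * (2 * tau)]. *)
Lemma expintN_ge a tau x : 0 <= a -> 0 <= tau -> a * tau <= 8^-1 ->
  3 * tau <= x -> 2 * tau <= expint (- a) x.
Proof.
move=> + tau0 at8 tx; rewrite le_eqVlt => /predU1P[<-|a0].
  by rewrite oppr0 /expint eqxx; lra.
rewrite -(ler_pM2l a0).
have -> : a * expint (- a) x = 1 - expR (- a * x).
  by have := expintE (- a) x; lra.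
set z := a * (3 * tau).
have ez : expR (- a * x) <= expR (- z).
  by rewrite ler_expR mulNr lerN2 ler_pM2l.
have z0 : 0 <= z by rewrite /z !mulr_ge0 ?(ltW a0).
have z8 : z <= 2^-1 by rewrite /z; lra.
have e1 : expR (- z) <= (1 + z)^-1.
  rewrite expRN lef_pV2 ?posrE ?expR_gt0 ?expR_ge1Dx//; lra.
have zz : (1 + z)^-1 <= 1 - 2 / 3 * z.
  rewrite -[leLHS]mul1r ler_pdivrMr; last by lra.
  have := ler_wpM2l z0 z8; lra.
by move: zz; rewrite /z; lra.
Qed.

End ExpDecay.

(** * Reduction of a general starting point to [U 0] *)

Theorem theorem5p9 (R : realType) (X : metricType R) (phi : X -> \bar R)
  (phi_proper : proper_functional phi) (phi_lsc : lower_semicontinuous phi)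
  (D : set X) (D_sub : D `<=` closure (Dom phi))
  (lambda : R) (lambda_le0 : lambda <= 0)
  (S : R -> X -> X) (S_flow : EVI_gradient_flow phi lambda D S)
  (tau eta : R) (tau_01 : 0 < tau < 1) (eta_ge0 : 0 <= eta)
  (tau_small : 4 * (2 * eta - 3 * lambda) * tau <= 1)
  (U : nat -> X) (U_D : forall n, (D `&` Dom phi) (U n))
  (U_MM : discrete_MM phi tau eta U)
  (phi_convex : approx_convex phi lambda D) :
  forall u0, D u0 -> forall t : R, 0 < t ->
  let gamma := 2 * eta - 3 * lambda in
  let t_tau := least_multiple tau t in
  let sigma := exp_integral (lambda - eta) (3 * Num.sqrt (tau * t_tau)) in
  ((mdist (S t u0) (interpolant tau U t))%:E <=
     (expR (- lambda * t) * mdist u0 (U 0%N))%:E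
     + (10 * (tau * t_tau) `^ 4^-1 * expR (2 * gamma * t_tau))%:E
       * sqrte (phi (U 0%N) - moreau_yosida phi sigma (U 0%N)))%E.
Proof.
move=> u0 Du0 t t_gt0; cbv zeta.
have [tau0 _] : 0 < tau /\ tau < 1 by apply/andP.
have [N [-> tleN Nmin]] := least_multiple_min t tau0.
have t0 := ltW t_gt0.
have N0 : (0 < N)%N.
  by rewrite lt0n; apply: contraTneq tleN => ->; rewrite mul0r -ltNge.
have Nt : (N%:R - 1) * tau < t.
  rewrite ltNge; apply/negP; case: N N0 Nmin {tleN} => // N _ Nmin.
  rewrite -natr1 addrK => /Nmin; rewrite ler_pM2r// ler_nat.
  by rewrite ltnn.
rewrite (interpolantE U tau0 N0) ?Nt//.
set T := Num.sqrt (tau * (N%:R * tau)).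
set sigma := exp_integral _ _.
have NR1 : 1 <= N%:R :> R by rewrite ler1n.
have T0 : 0 <= T := sqrtr_ge0 _.
have tauT : tau <= T.
  have tt0 : 0 <= tau * tau by rewrite mulr_ge0 ?(ltW tau0).
  apply: le_of_sqr => //; rewrite sqr_sqrtr; last by rewrite !mulr_ge0 ?(ltW tau0).
  by have := ler_wpM2r tt0 NR1; lra.
have L0 : 0 <= - lambda by rewrite oppr_ge0.
have a0 : 0 <= - lambda + eta by rewrite addr_ge0.
have T30 : 0 <= 3 * T by lra.
have sigmaE : sigma = expint (- (- lambda + eta)) (3 * T).
  by rewrite /sigma exp_integralE// opprD opprK.
have a8 : (- lambda + eta) * tau <= 8^-1.
  by have := mulr_ge0 L0 (ltW tau0); lra.
have s2 : 2 * tau <= sigma.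
  by rewrite sigmaE; apply: expintN_ge => //; [exact: ltW|rewrite ler_pM2l].
have s3 : sigma <= 3 * T by rewrite sigmaE expintN_le.
have sigma_gt0 : 0 < sigma by lra.
have Ls : - lambda * sigma <= 1.
  apply: le_trans (_ : (- lambda + eta) * sigma <= 1).
    by rewrite ler_wpM2r ?(ltW sigma_gt0)// lerDl.
  by rewrite sigmaE expintN_mul_le1.
have sT : 3 * T <= sigma * expR ((- lambda + eta) * (3 * T)).
  by rewrite sigmaE le_expintN_expR.
have -> : (tau * (N%:R * tau)) `^ 4^-1 = Num.sqrt T.
  have -> : 4^-1 = 2^-1 * 2^-1 :> R by field.
  by rewrite powRrM !powR12_sqrt// mulr_ge0 ?mulr_ge0 ?(ltW tau0).
have T_gt0 : 0 < T by lra.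
have c_gt0 : 0 < 10 * Num.sqrt T * expR (2 * (2 * eta - 3 * lambda) * (N%:R * tau)).
  by apply: mulr_gt0 (expR_gt0 _); apply: mulr_gt0 => //; rewrite sqrtr_gt0.
set c := 10 * _ * _ in c_gt0 *.
have [D0 f0] := U_D 0.
have my_le V : (moreau_yosida phi sigma (U 0%N) <=
    phi V + ((2 * sigma)^-1 * mdist V (U 0%N) ^+ 2)%:E)%E.
  by apply: ereal_inf_lbound; exists V.
have my_le0 : (moreau_yosida phi sigma (U 0%N) <= phi (U 0%N))%E.
  by have := my_le (U 0%N); rewrite mdistxx expr0n mulr0 adde0.
rewrite -(fine_phiK phi_proper f0) in my_le0 *.
case: (moreau_yosida phi sigma (U 0%N)) my_le my_le0 => [m||] my_le my_le0.
- have m_le : m <= fine (phi (U 0%N)) by move: my_le0; rewrite lee_fin.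
  rewrite -EFinB /= -EFinM -EFinD lee_fin.
  have := @error_estimate R X phi D lambda tau eta S U phi_proper phi_lsc
    lambda_le0 S_flow tau0 eta_ge0 tau_small U_D U_MM phi_convex sigma
    (fine (phi (U 0%N)) - m) sigma_gt0 _ _ N t t0 tleN _ N0 s2 s3 Ls sT.
  rewrite -/T -/c => est.
  (* Contraction from [u0] to [U 0] gives the first term, [error_estimate] the second. *)
  apply: le_trans (metric_triangle _ (S t (U 0%N)) _) _.
  apply: lerD.
    rewrite -!flowE//.
    exact: flow_contraction phi_proper phi_lsc lambda_le0 S_flow _ _ _ Du0 D0 t0.
  rewrite -flowE//; apply: est; first by rewrite subr_ge0.
  + move=> V fV; have := my_le V.
    by rewrite -(fine_phiK phi_proper fV) -EFinD lee_fin /=; lra.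
  + by lra.
- by move: my_le0; rewrite leye_eq.
(* If the regularization is [-oo], the right-hand side is [+oo] because [c] is positive. *)
- rewrite (_ : (_ - -oo)%E = +oo%E)//= gt0_muley ?lte_fin//.
  by rewrite leey.
Qed.
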